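(* Let $\mathfrak g$ be a simple Lie algebra of finite $ADE$ type, let $\mathtt b\in\mathrm{Br}^+$, let $\underline\Delta\in\mathrm{Seq}(\Delta)$, and let $\mathfrak C$ be an admissible chain of $i$-boxes associated with $\boldsymbol i\in\mathrm{Seq}(\mathtt b)$. Then $$Q(\mathfrak C)=Q(\underline{\mathsf h}(\mathfrak C))=Q(\mathfrak W_{\underline\Delta}(\mathfrak C))^{\mathrm{op}}$$ as labeled quivers, where $\underline{\mathsf h}(\mathfrak C)$ is the signed word associated with $\mathfrak C$ and $\mathfrak W_{\underline\Delta}(\mathfrak C)$ is the Demazure weave associated with $\mathfrak C$.
   Context: **Basic notation.** $[a,b]$ denotes the integer interval, empty if $a>b$. $(c_{i,j})_{i,j\in I}$ is the Cartan matrix of $\mathfrak g$, $\alpha_i$ the simple roots with $(\alpha_i,\alpha_j)=c_{i,j}$; $W=\langle s_i\rangle$ is the Weyl group, $w_\circ$ its longest element, $i\mapsto i^*$ is the involution $\alpha_{i^*}=-w_\circ(\alpha_i)$. $\mathrm{Br}^+$ is the positive braid monoid with generators $\sigma_i$ ($i\in I$) and the braid relations; $\mathrm{Seq}(\mathtt b)$ is the set of words $(i_1,\dots,i_r)$ with $\mathtt b=\sigma_{i_1}\cdots\sigma_{i_r}$. $\Delta\in \mathrm{Br}^+$ is the canonical (minimal) lift of $w_\circ$. The Demazure product $\delta:\mathrm{Br}^+\to W$ is given by $\delta(1)=1$ and $\delta(\mathtt b\sigma_i)=\delta(\mathtt b)s_i$ if this is longer than $\delta(\mathtt b)$, and $\delta(\mathtt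 b\sigma_i)=\delta(\mathtt b)$ otherwise; $\delta$ of a word is $\delta$ of the braid it expresses. Juxtaposition of words is concatenation. $Q^{\mathrm{op}}$ is $Q$ with all arrows reversed and the same labels. Quivers have no arrows between frozen vertices. **$i$-boxes.** Fix $\boldsymbol i=(i_1,\dots,i_r)$. For $k\in[1,r]$, $j\in I$: $k(j)^+=\min(\{t\in[1,r]: t\ge k, i_t=j\}\cup\{+\infty\})$, $k(j)^-=\max(\{t\in[1,r]: t\le k,i_t=j\}\cup\{-\infty\})$; $k^+$ (resp. $k^-$) is the next (resp. previous) position strictly after (before) $k$ with letter $i_k$ ($\pm\infty$ if none). An $i$-box is an interval $[a,b]\subseteq[1,r]$ with $a\le b$, $i_a=i_b$; its color is $i_a$. Put $[a,b\}=[a,b(i_a)^-]$, $\{a,b]=[a(i_b)^+,b]$. An admissible chain $\mathfrak C=(\mathfrak c_t)_{1\le t\le r}$ is a sequence of $i$-boxes such that for each $t$ the envelope $\widetilde{\mathfrak c}_t=\bigcup_{j\le t}\mathfrak c_j=[\tilde a_t,\tilde b_t]$ is an interval of cardinality $t$ and $\mathfrak c_t$ is $[\tilde a_t,\tilde b_t\}$ or $\{\tilde a_t,\tilde b_t]$. It is determined by $c\in[1,r]$ with $\widetilde{\mathfrak c}_1=[c,c]$ and the LR sequence $(\mathcal H_1,\dots,\mathcal H_{r-1})\in\{\mathcal L,\mathcal R\}^{r-1}$: for $t\ge2$, if $\mathcal H_{t-1}=\mathcal L$ then $\widetilde{\mathfrak c}_t=[\tilde a_{t-1}-1,\tilde b_{t-1}]$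 and $\mathfrak c_t=[\tilde a_t,\tilde b_t\}$; if $\mathcal H_{t-1}=\mathcal R$ then $\widetilde{\mathfrak c}_t=[\tilde a_{t-1},\tilde b_{t-1}+1]$ and $\mathfrak c_t=\{\tilde a_t,\tilde b_t]$. The effective end $z_{\mathfrak c_t}$ is the unique element of $\widetilde{\mathfrak c}_t\setminus\widetilde{\mathfrak c}_{t-1}$ ($\widetilde{\mathfrak c}_0=\emptyset$). **Quiver $Q(\mathfrak C)$.** Vertices $1,\dots,r$ ($t$ corresponds to $\mathfrak c_t$); $t$ is frozen iff $\mathfrak c_t=[1(i)^+,r(i)^-]$ for some $i\in I$. Let $(b_{\mathfrak c_p,\mathfrak c_q})$ be the skew-symmetric matrix with entries in $\{-1,0,1\}$ such that $b_{[x,y],[x',y']}=1$ iff one of: ($x=x'$, $y'=y^-$); ($y=y'$, $x'=x^-$); or $(\alpha_{i_x},\alpha_{i_{x'}})=-1$ and one of (1) $[x,y^+]\in\mathfrak C$, $z_{[x,y]}=x$, $x'^-<x<x'$, $y'<y^+<y'^+$; (2) $[x,y^+]\in\mathfrak C$, $z_{[x',y']}=y'$, $x'^-<x$, $y<y'<y^+<y'^+$; (3) $[x'^-,y']\in\mathfrak C$, $z_{[x',y']}=y'$, $x^-<x'^-<x$, $y<y'<y^+$; (4) $[x'^-,y']\in\mathfrak C$, $z_{[x,y]}=x$, $x^-<x'^-<x<x'$, $y'<y^+$. There is an arrow $p\to q$ iff $b_{\mathfrak c_p,\mathfrak c_q}=1$ and $p,q$ are not both frozen. **Signed words.** A signed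 word is $\underline{\mathsf h}=(\epsilon_1h_1,\dots,\epsilon_rh_r)$ with $h_t\in I$, $\epsilon_t\in\{\pm1\}$. In this paragraph $j^+$ denotes the next position after $j$ with the same letter in the word $(h_1,\dots,h_r)$ ($+\infty$ if none). $Q(\underline{\mathsf h})$ has vertices $1,\dots,r$; $j$ is frozen iff $j^+=+\infty$. Its exchange matrix $(b_{j,t})$ ($j$ arbitrary, $t$ non-frozen) is: $b_{j,t}=\epsilon_t$ if $t=j^+$; $-\epsilon_j$ if $j=t^+$; $\epsilon_tc_{h_j,h_t}$ if $\epsilon_{j^+}=\epsilon_t$ and $j<t<j^+<t^+$; $\epsilon_tc_{h_j,h_t}$ if $\epsilon_t=-\epsilon_{t^+}$ and $j<t<t^+<j^+$; $-\epsilon_jc_{h_j,h_t}$ if $\epsilon_{t^+}=\epsilon_j$ and $t<j<t^+<j^+$; $-\epsilon_jc_{h_j,h_t}$ if $\epsilon_j=-\epsilon_{j^+}$ and $t<j<j^+<t^+$; $0$ otherwise. There are $b_{j,t}$ arrows $j\to t$ if $b_{j,t}>0$ and $-b_{j,t}$ arrows $t\to j$ if $b_{j,t}<0$. The signed word $\underline{\mathsf h}(\mathfrak C)=(\epsilon_th_t)_{1\le t\le r}$ has $h_t=\mathrm{color}(\mathfrak c_t)$, $\epsilon_t=+1$ if $t=1$ or $\mathcal H_{t-1}=\mathcal L$, and $\epsilon_t=-1$ if $t\geq 2$ and $\mathcal H_{t-1}=\mathcal R$. **Demazure weaves.** A weave $\mathfrak W:\boldsymbol j\to\boldsymbol j'$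 is a planar graph with edges colored by $I$, oriented downwards, whose horizontal slices are words starting with $\boldsymbol j$ at the top and ending with $\boldsymbol j'$ at the bottom, successive slices differing by one vertex: 6-valent ($iji\to jij$, $i,j$ adjacent in the Dynkin diagram), 4-valent ($ik\to ki$, $i\ne k$ non-adjacent), or 3-valent ($ii\to i$). It is a Demazure weave on $\boldsymbol j$ if $\boldsymbol j'$ is a reduced word of $\delta(\boldsymbol j)$, written $\mathfrak W:\boldsymbol j\to\delta(\boldsymbol j)$. Two weaves are equivalent if related by the standard local moves involving at most one trivalent vertex; equivalent weaves give the same quiver. *Lusztig cycles and quiver.* For a trivalent vertex $v$, $\gamma_v$ assigns a nonnegative integer to each edge: $1$ to the outgoing edge of $v$, $0$ to top boundary strands and to edges not obtained by propagation from $v$, and propagates downward at all other vertices by: 3-valent, $(a,b)\mapsto\min(a,b)$; 4-valent, $(a,b)\mapsto(b,a)$; 6-valent, $(a,b,c)\mapsto(b+c-\min(a,c),\min(a,c),a+b-\min(a,c))$. For cycles $\gamma,\gamma'$ and edges $e,f,g$ let $D(e,f,g)$ be the determinant of the $3\times3$ matrix with rows $(1,1,1)$, $(\gamma(e),\gamma(f),\gamma(g))$, $(\gamma'(e),\gamma'(f),\gamma'(g))$. The local intersection $\sharp(\gamma,\gamma')$ is $D(\text{top left},\text{bottom},\text{top right})$ at a 3-valent vertex; $\tfrac12\bigl(D(\text{top left},\text{bottom middle},\text{top right})+D(\text{bottom left},\text{bottom right},\text{top middle})\bigr)$ at a 6-valent vertex; $0$ at a 4-valent vertex. $Q(\mathfrak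 W)$ has the trivalent vertices as vertices; $v$ is frozen iff $\gamma_v$ is nonzero on some bottom boundary edge; if $v,v'$ are not both frozen, the number of arrows $v\to v'$ minus those $v'\to v$ is the sum of $\sharp(\gamma_v,\gamma_{v'})$ over all vertices of $\mathfrak W$. Trivalent vertices are labeled $1,2,\dots$ from top to bottom. *Double inductive weaves.* A double string is $\mathbf s=(i_1\mathbf X_1,\dots,i_m\mathbf X_m)$ with $\mathbf X_t\in\{\mathbf L,\mathbf R\}$; starting from the empty word, step $t$ adds $i_t$ on the left or right according to $\mathbf X_t$; the final word is $\boldsymbol i(\mathbf s)$. The weave $\mathfrak W(\mathbf s):\boldsymbol i(\mathbf s)\to\delta(\boldsymbol i(\mathbf s))$ is built accordingly: at step $t$ add a strand of color $i_t$ (extending to the top) on side $\mathbf X_t$; if the length of the Demazure product does not increase, first apply 4-/6-valent moves at the bottom of the current weave so that its outermost strand on side $\mathbf X_t$ has color $i_t$, then merge it with the new strand in a 3-valent vertex. It is well defined up to equivalence. *The weave $\mathfrak W_{\underline\Delta}(\mathfrak C)$.* Put $\mathcal H_0=\mathcal R$, $\underline\Delta=(j_1,\dots,j_\ell)$, and $\mathbf s_{\underline\Delta}(\mathfrak C)=(j_1\mathbf R,\dots,j_\ell\mathbf R,h_1\mathbf X_1,\dots,h_r\mathbf X_r)$, where $(h_t,\mathbf X_t)=(\mathrm{color}(\mathfrak c_t)^*,\mathbf L)$ if $\mathcal H_{t-1}=\mathcal L$ and $(\mathrm{color}(\mathfrak c_t),\mathbf R)$ if $\mathcal H_{t-1}=\mathcal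 R$. Let $\boldsymbol i_{\underline\Delta}(\mathfrak C)=\boldsymbol i(\mathbf s_{\underline\Delta}(\mathfrak C))$ (an expression of $\Delta\mathtt b$), $\mathfrak W^B_{\underline\Delta}(\mathfrak C)=\mathfrak W(\mathbf s_{\underline\Delta}(\mathfrak C))$, and let $\mathfrak W^T_{\underline\Delta}(\mathfrak C):\underline\Delta\,\boldsymbol i\to\boldsymbol i_{\underline\Delta}(\mathfrak C)$ be any weave with only 4- and 6-valent vertices. Then $\mathfrak W_{\underline\Delta}(\mathfrak C)=\mathfrak W^B_{\underline\Delta}(\mathfrak C)\circ\mathfrak W^T_{\underline\Delta}(\mathfrak C)$ (the $B$-part placed below the $T$-part), a Demazure weave on $\underline\Delta\,\boldsymbol i$; its quiver does not depend on the choice of $\mathfrak W^T$. *)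

(* Defs.v *)
From mathcomp Require Import all_boot all_order all_algebra all_fingroup.

Set Implicit Arguments.
Unset Strict Implicit.
Unset Printing Implicit Defensive.

Import Order.TTheory GRing.Theory Num.Theory.

Inductive dynkin_type := DynA | DynD | DynE.

Definition dynkin_rank (X : dynkin_type) (r : nat) : bool :=
  match X with
  | DynA => 0 < r
  | DynD => 3 < r
  | DynE => 5 < r < 9
  end.

(* Nodes 0, ..., r-1.  In types D and E the nodes 0, ..., r-2 form a chain, and
   r-1 is joined to r-3 in type D, to 2 in type E. *)
Definition dynkin_edge_lt (X : dynkin_type) (r i j : nat) : bool :=
  match X with
  | DynA => j == i.+1
  | DynD => (j == i.+1) && (j < r.-1) || (i == r - 3) && (j == r.-1)
  | DynE => (j == i.+1) && (j < r.-1) || (i == 2) && (j == r.-1)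
  end.

Definition dynkin_edge (X : dynkin_type) (r i j : nat) : bool :=
  (i < j) && dynkin_edge_lt X r i j || (j < i) && dynkin_edge_lt X r j i.

Definition dynkin_cartan (X : dynkin_type) (n : nat) : 'M[int]_n.+1 :=
  (\matrix_(i, j) if i == j then 2 else if dynkin_edge X n.+1 i j then -1 else 0)%R.

(* A simple Lie algebra has positive rank, so its rank is written n.+1 and its
   index set I is 'I_n.+1, with an arbitrary numbering of the Dynkin nodes. *)
Definition ADE_cartan (n : nat) (C : 'M[int]_n.+1) : Prop :=
  exists (X : dynkin_type) (p : 'S_n.+1),
    dynkin_rank X n.+1 /\
    forall i j, C (p i) (p j) = dynkin_cartan X n i j.

(* Elements of the root lattice are integer column vectors in the basis of
   simple roots, and elements of the Weyl group are matrices acting on them. *)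
Definition simple_root (n : nat) (i : 'I_n.+1) : 'cV[int]_n.+1 := delta_mx i ord0.

(* s_i (alpha_j) = alpha_j - c_(i,j) alpha_i *)
Definition refl (n : nat) (C : 'M[int]_n.+1) (i : 'I_n.+1) : 'M[int]_n.+1 :=
  (1%:M - delta_mx i i *m C)%R.

Definition word_mx (n : nat) (C : 'M[int]_n.+1) (s : seq 'I_n.+1) : 'M[int]_n.+1 :=
  (\prod_(i <- s) refl C i)%R.

Record weyl (n : nat) (C : 'M[int]_n.+1) := Weyl {
  weyl_mx :> 'M[int]_n.+1;
  weyl_word : exists s, weyl_mx = word_mx C s }.

Lemma weyl1_subproof (n : nat) (C : 'M[int]_n.+1) :
  exists s, (1 : 'M[int]_n.+1)%R = word_mx C s.
Proof. by exists [::]; rewrite /word_mx big_nil. Qed.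

Definition weyl1 (n : nat) (C : 'M[int]_n.+1) : weyl C := Weyl (weyl1_subproof C).

Lemma weyl_mulr_subproof (n : nat) (C : 'M[int]_n.+1) (w : weyl C) (i : 'I_n.+1) :
  exists s, (weyl_mx w * refl C i)%R = word_mx C s.
Proof.
case: (weyl_word w) => s Ds; exists (rcons s i).
by rewrite Ds /word_mx -cats1 big_cat big_seq1.
Qed.

Definition weyl_mulr (n : nat) (C : 'M[int]_n.+1) (w : weyl C) (i : 'I_n.+1) : weyl C :=
  Weyl (weyl_mulr_subproof w i).

Definition expressed_in (n : nat) (C : 'M[int]_n.+1) (w : weyl C) (k : nat) : bool :=
  [exists s : k.-tuple 'I_n.+1, weyl_mx w == word_mx C s].

Lemma weyl_length_subproof (n : nat) (C : 'M[int]_n.+1) (w : weyl C) :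
  exists k, expressed_in w k.
Proof.
case: (weyl_word w) => s Ds; exists (size s).
by apply/existsP; exists (in_tuple s); rewrite Ds.
Qed.

Definition weyl_length (n : nat) (C : 'M[int]_n.+1) (w : weyl C) : nat :=
  ex_minn (weyl_length_subproof w).

Definition longest (n : nat) (C : 'M[int]_n.+1) (w0 : weyl C) : Prop :=
  forall w : weyl C, weyl_length w <= weyl_length w0.

Definition reduced_word (n : nat) (C : 'M[int]_n.+1) (w : weyl C)
    (s : seq 'I_n.+1) : Prop :=
  weyl_mx w = word_mx C s /\ size s = weyl_length w.

(* The index j with alpha_j = - w0 (alpha_i); the default value i is not used
   when w0 is the longest element. *)
Definition star (n : nat) (C : 'M[int]_n.+1) (w0 : weyl C) (i : 'I_n.+1) : 'I_n.+1 :=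
  odflt i [pick j | simple_root j == - (weyl_mx w0 *m simple_root i)]%R.

(* An element of the positive braid monoid is given by a word that expresses
   it; two words express the same element iff they are related by braid_eq. *)
Inductive braid_eq (n : nat) (C : 'M[int]_n.+1) :
    seq 'I_n.+1 -> seq 'I_n.+1 -> Prop :=
| braid_refl s : braid_eq C s s
| braid_sym s t : braid_eq C s t -> braid_eq C t s
| braid_trans s t u : braid_eq C s t -> braid_eq C t u -> braid_eq C s u
| braid_comm u v i j : i != j -> C i j = 0%R ->
    braid_eq C (u ++ [:: i; j] ++ v) (u ++ [:: j; i] ++ v)
| braid_braid u v i j : C i j = (- 1)%R ->
    braid_eq C (u ++ [:: i; j; i] ++ v) (u ++ [:: j; i; j] ++ v).

Definition Seq_of (n : nat) (C : 'M[int]_n.+1) (b s : seq 'I_n.+1) : Prop :=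
  braid_eq C b s.

Definition demazure (n : nat) (C : 'M[int]_n.+1) (s : seq 'I_n.+1) : weyl C :=
  foldl (fun w i => if weyl_length w < weyl_length (weyl_mulr w i)
                    then weyl_mulr w i else w) (weyl1 C) s.

(* The vertex labeled t, for 1 <= t <= r, is the ordinal t-1 of 'I_r.
   quiver_arrows p q is the number of arrows from p to q.  It is rational
   because the intersection numbers of cycles of a weave are defined with a
   factor 1/2. *)
Record quiver := Quiver {
  quiver_size : nat;
  quiver_frozen : {set 'I_quiver_size};
  quiver_arrows : 'M[rat]_quiver_size }.

Definition quiver_op (Q : quiver) : quiver :=
  Quiver (quiver_frozen Q) (quiver_arrows Q)^T%R.

(* Arrows between two frozen vertices are discarded. *)
Definition mk_quiver (r : nat) (frozen : nat -> bool) (arrows : nat -> nat -> rat) :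
    quiver :=
  @Quiver r [set t : 'I_r | frozen t.+1]
    (\matrix_(p, q) if frozen p.+1 && frozen q.+1 then 0
                    else arrows p.+1 q.+1)%R.

(* Positions in a word of length r are 1, ..., r; the values +oo and -oo are
   encoded as r+1 and 0. *)
Definition letter (n : nat) (w : seq 'I_n.+1) (t : nat) : 'I_n.+1 :=
  nth ord0 w t.-1.

Definition positions (n : nat) (w : seq 'I_n.+1) : seq nat := iota 1 (size w).

(* k(j)^+ and k(j)^- *)
Definition occ_ge (n : nat) (w : seq 'I_n.+1) (j : 'I_n.+1) (k : nat) : nat :=
  head (size w).+1 [seq t <- positions w | (k <= t) && (letter w t == j)].

Definition occ_le (n : nat) (w : seq 'I_n.+1) (j : 'I_n.+1) (k : nat) : nat :=
  last 0 [seq t <- positions w | (t <= k) && (letter w t == j)].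

(* k^+ and k^- *)
Definition next_pos (n : nat) (w : seq 'I_n.+1) (k : nat) : nat :=
  head (size w).+1 [seq t <- positions w | (k < t) && (letter w t == letter w k)].

Definition prev_pos (n : nat) (w : seq 'I_n.+1) (k : nat) : nat :=
  last 0 [seq t <- positions w | (t < k) && (letter w t == letter w k)].

(* The pair (a, b) stands for the interval [a, b]. *)
Definition ibox (n : nat) (w : seq 'I_n.+1) (c : nat * nat) : bool :=
  [&& 1 <= c.1, c.1 <= c.2, c.2 <= size w & letter w c.1 == letter w c.2].

(* [a, b} and {a, b] *)
Definition box_l (n : nat) (w : seq 'I_n.+1) (a b : nat) : nat * nat :=
  (a, occ_le w (letter w a) b).

Definition box_r (n : nat) (w : seq 'I_n.+1) (a b : nat) : nat * nat :=
  (occ_ge w (letter w b) a, b).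

Definition box (ch : seq (nat * nat)) (t : nat) : nat * nat := nth (0, 0) ch t.-1.

Definition color (n : nat) (w : seq 'I_n.+1) (ch : seq (nat * nat)) (t : nat) :
    'I_n.+1 :=
  letter w (box ch t).1.

Definition in_envelope (ch : seq (nat * nat)) (t k : nat) : bool :=
  has (fun c => c.1 <= k <= c.2) (take t ch).

Definition admissible_chain (n : nat) (w : seq 'I_n.+1) (ch : seq (nat * nat)) : Prop :=
  [/\ size ch = size w,
      forall c, c \in ch -> ibox w c &
      forall t, 1 <= t <= size w ->
        exists a b : nat,
          [/\ forall k, in_envelope ch t k = (a <= k <= b),
              b.+1 = a + t &
              box ch t = box_l w a b \/ box ch t = box_r w a b]].

Definition env_left (ch : seq (nat * nat)) (t : nat) : nat :=
  foldr minn (box ch 1).1 [seq c.1 | c <- take t ch].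

Inductive side := Lft | Rgt.

(* H_t for 0 <= t < r, with H_0 = R *)
Definition LR (ch : seq (nat * nat)) (t : nat) : side :=
  if (0 < t) && (env_left ch t.+1 < env_left ch t) then Lft else Rgt.

Definition effective_end (n : nat) (w : seq 'I_n.+1) (ch : seq (nat * nat)) (t : nat) :
    nat :=
  head 0 [seq k <- positions w | in_envelope ch t k && ~~ in_envelope ch t.-1 k].

Section ChainQuiver.

Context (n : nat) (C : 'M[int]_n.+1) (w : seq 'I_n.+1) (ch : seq (nat * nat)).

Let pl := next_pos w.
Let mi := prev_pos w.
Let z := effective_end w ch.

(* b_(c_p, c_q) = 1 *)
Definition box_arrow (p q : nat) : bool :=
  let: (x, y) := box ch p in
  let: (x', y') := box ch q in
  [|| (x == x') && (y' == mi y),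
      (y == y') && (x' == mi x) |
      (C (letter w x) (letter w x') == - 1)%R &&
      [|| [&& (x, pl y) \in ch, z p == x, mi x' < x < x' & y' < pl y < pl y'],
          [&& (x, pl y) \in ch, z q == y', mi x' < x & y < y' < pl y]
            && (pl y < pl y'),
          [&& (mi x', y') \in ch, z q == y', mi x < mi x' < x & y < y' < pl y] |
          [&& (mi x', y') \in ch, z p == x, mi x < mi x' < x & x < x']
            && (y' < pl y)]].

Definition box_frozen (t : nat) : bool :=
  [exists i : 'I_n.+1, box ch t == (occ_ge w i 1, occ_le w i (size w))].

Definition chain_quiver : quiver :=
  mk_quiver (size w) box_frozen (fun p q => (box_arrow p q)%:R%R).

End ChainQuiver.

(* The pair (e, h) stands for the letter +h if e = true, for -h otherwise. *)
Definition signed_word (n : nat) : Type := seq (bool * 'I_n.+1).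

Definition sign_at (n : nat) (sw : signed_word n) (t : nat) : int :=
  if (nth (true, ord0) sw t.-1).1 then 1%R else (- 1)%R.

Section SignedQuiver.

Context (n : nat) (C : 'M[int]_n.+1) (sw : signed_word n).

Let h : seq 'I_n.+1 := [seq x.2 | x <- sw].
Let e := sign_at sw.
Let pl := next_pos h.

Definition signed_frozen (j : nat) : bool := pl j == (size sw).+1.

Definition signed_exchange (j t : nat) : int :=
  let c := C (letter h j) (letter h t) in
  (if t == pl j then e t
   else if j == pl t then - e j
   else if (e (pl j) == e t) && (j < t < pl j)%N && (pl j < pl t)%N then e t * c
   else if (e t == - e (pl t)) && (j < t < pl t)%N && (pl t < pl j)%N then e t * c
   else if (e (pl t) == e j) && (t < j < pl t)%N && (pl t < pl j)%N then - e j * c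
   else if (e j == - e (pl j)) && (t < j < pl j)%N && (pl j < pl t)%N then - e j * c
   else 0)%R.

(* The exchange matrix is only used with a non-frozen second index. *)
Definition signed_arrows (p q : nat) : rat :=
  (if ~~ signed_frozen q then (Num.max 0 (signed_exchange p q))%:~R
   else if ~~ signed_frozen p then (Num.max 0 (- signed_exchange q p))%:~R
   else 0)%R.

Definition signed_quiver : quiver :=
  mk_quiver (size sw) signed_frozen signed_arrows.

End SignedQuiver.

Definition chain_signed_word (n : nat) (w : seq 'I_n.+1) (ch : seq (nat * nat)) :
    signed_word n :=
  [seq ((t == 1) || (if LR ch t.-1 is Lft then true else false), color w ch t)
     | t <- iota 1 (size w)].

(* A weave is the list of its vertices, from top to bottom.  The natural number
   is the number of strands on the left of the vertex in its slice. *)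
Inductive vertex :=
| Trivalent of nat
| Fourvalent of nat
| Sixvalent of nat.

Definition weave : Type := seq vertex.

Definition is_trivalent (v : vertex) : bool :=
  if v is Trivalent _ then true else false.

(* The slice below v, if v can be placed below the slice s. *)
Definition apply_vertex (n : nat) (C : 'M[int]_n.+1) (v : vertex) (s : seq 'I_n.+1) :
    option (seq 'I_n.+1) :=
  match v with
  | Trivalent p =>
      if drop p s is i :: j :: u then
        if i == j then Some (take p s ++ i :: u) else None
      else None
  | Fourvalent p =>
      if drop p s is i :: j :: u then
        if (i != j) && (C i j == 0%R) then Some (take p s ++ j :: i :: u) else None
      else None
  | Sixvalent p =>
      if drop p s is i :: j :: k :: u then
        if (k == i) && (C i j == (- 1)%R)
        then Some (take p s ++ j :: i :: j :: u) else None
      else None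
  end.

(* W is a weave from the word s to the word s'. *)
Definition is_weave (n : nat) (C : 'M[int]_n.+1) (W : weave) (s s' : seq 'I_n.+1) :
    Prop :=
  foldl (fun o v => obind (apply_vertex C v) o) (Some s) W = Some s'.

(* A cycle is recorded by its values on the strands of each slice. *)
Definition propagate (v : vertex) (g : seq nat) : seq nat :=
  match v with
  | Trivalent p =>
      let a := nth 0 g p in let b := nth 0 g p.+1 in
      take p g ++ minn a b :: drop p.+2 g
  | Fourvalent p =>
      let a := nth 0 g p in let b := nth 0 g p.+1 in
      take p g ++ b :: a :: drop p.+2 g
  | Sixvalent p =>
      let a := nth 0 g p in let b := nth 0 g p.+1 in let c := nth 0 g p.+2 in
      take p g ++ b + c - minn a c :: minn a c :: a + b - minn a c :: drop p.+3 g
  end.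

Definition vertex_at (W : weave) (k : nat) : vertex := nth (Trivalent 0) W k.

(* The values on slice m of the cycle of the trivalent vertex vertex_at W k,
   where l is the number of top boundary strands; slice m is directly above
   vertex_at W m. *)
Fixpoint lusztig_cycle (W : weave) (l k m : nat) : seq nat :=
  if m is m'.+1 then
    let v := vertex_at W m' in
    let g := propagate v (lusztig_cycle W l k m') in
    if v is Trivalent p then (if m' == k then set_nth 0 g p 1 else g) else g
  else nseq l 0.

Definition det3 (g g' : nat * nat * nat) : rat :=
  let: (a, b, c) := g in let: (a', b', c') := g' in
  (\det (\matrix_(i < 3, j < 3)
     nth 0 (nth [::] [:: [:: 1; 1; 1];
                         [:: a%:R; b%:R; c%:R];
                         [:: a'%:R; b'%:R; c'%:R]] i) j))%R.

(* Local intersection at v of two cycles with values g1 and g2 on the slice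
   above v, and g1' and g2' on the slice below v. *)
Definition local_intersection (v : vertex) (g1 g1' g2 g2' : seq nat) : rat :=
  match v with
  | Trivalent p =>
      let edges g g' := (nth 0 g p, nth 0 g' p, nth 0 g p.+1) in
      det3 (edges g1 g1') (edges g2 g2')
  | Fourvalent _ => 0%R
  | Sixvalent p =>
      let edges g g' := (nth 0 g p, nth 0 g' p.+1, nth 0 g p.+2) in
      let edges' g g' := (nth 0 g' p, nth 0 g' p.+2, nth 0 g p.+1) in
      (2^-1 * (det3 (edges g1 g1') (edges g2 g2')
               + det3 (edges' g1 g1') (edges' g2 g2')))%R
  end.

Definition intersection (W : weave) (l k k' : nat) : rat :=
  (\sum_(0 <= m < size W)
     local_intersection (vertex_at W m)
       (lusztig_cycle W l k m) (lusztig_cycle W l k m.+1)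
       (lusztig_cycle W l k' m) (lusztig_cycle W l k' m.+1))%R.

Definition trivalent_indices (W : weave) : seq nat :=
  [seq k <- iota 0 (size W) | is_trivalent (vertex_at W k)].

(* The quiver of a weave on the word s; it has no 2-cycles. *)
Definition weave_quiver (n : nat) (s : seq 'I_n.+1) (W : weave) : quiver :=
  let tri t := nth 0 (trivalent_indices W) t.-1 in
  let l := size s in
  mk_quiver (size (trivalent_indices W))
    (fun t => has (fun x => x != 0) (lusztig_cycle W l (tri t) (size W)))
    (fun p q => Num.max 0 (intersection W l (tri p) (tri q)))%R.

Definition double_string (n : nat) : Type := seq ('I_n.+1 * side).

Definition add_strand (n : nat) (s : seq 'I_n.+1) (x : 'I_n.+1 * side) : seq 'I_n.+1 :=
  if x.2 is Lft then x.1 :: s else rcons s x.1.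

Definition string_word (n : nat) (ds : double_string n) : seq 'I_n.+1 :=
  foldl (@add_strand n) [::] ds.

Definition shift_vertex (v : vertex) : vertex :=
  match v with
  | Trivalent p => Trivalent p.+1
  | Fourvalent p => Fourvalent p.+1
  | Sixvalent p => Sixvalent p.+1
  end.

(* Extending a weave by a strand, from top to bottom, on one side. *)
Definition shift_weave (X : side) (W : weave) : weave :=
  if X is Lft then map shift_vertex W else W.

(* Position of the outermost trivalent vertex on side X, when l is the number
   of strands of the slice below it. *)
Definition merge_position (X : side) (l : nat) : nat :=
  if X is Lft then 0 else l.-1.

(* double_inductive C ds W s: W is a weave of the double string ds, from
   string_word ds to s, for some choice of the 4- and 6-valent moves V performed
   before each merge. *)
Inductive double_inductive (n : nat) (C : 'M[int]_n.+1) :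
    double_string n -> weave -> seq 'I_n.+1 -> Prop :=
| di_nil : double_inductive C [::] [::] [::]
| di_add ds W s x :
    double_inductive C ds W s ->
    weyl_length (demazure C (string_word ds))
      < weyl_length (demazure C (string_word (rcons ds x))) ->
    double_inductive C (rcons ds x) (shift_weave x.2 W) (add_strand s x)
| di_merge ds W s x V s' :
    double_inductive C ds W s ->
    weyl_length (demazure C (string_word (rcons ds x)))
      <= weyl_length (demazure C (string_word ds)) ->
    all (fun v => ~~ is_trivalent v) V ->
    is_weave C V s (add_strand s' x) ->
    double_inductive C (rcons ds x)
      (rcons (shift_weave x.2 (W ++ V))
             (Trivalent (merge_position x.2 (size (add_strand s' x)))))
      (add_strand s' x).

Definition chain_string (n : nat) (C : 'M[int]_n.+1) (w0 : weyl C)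
    (D w : seq 'I_n.+1) (ch : seq (nat * nat)) : double_string n :=
  [seq (j, Rgt) | j <- D] ++
  [seq (let X := LR ch t.-1 in
        (if X is Lft then star w0 (color w ch t) else color w ch t, X))
     | t <- iota 1 (size w)].

(* W = WT ++ WB is the weave of the chain ch, on the word D ++ w, for some choice
   of the top part WT and of the double inductive weave WB. *)
Definition chain_weave (n : nat) (C : 'M[int]_n.+1) (w0 : weyl C)
    (D w : seq 'I_n.+1) (ch : seq (nat * nat)) (W : weave) : Prop :=
  exists (WT WB : weave) (s : seq 'I_n.+1),
    let ds := chain_string w0 D w ch in
    [/\ all (fun v => ~~ is_trivalent v) WT,
        is_weave C WT (D ++ w) (string_word ds),
        double_inductive C ds WB s &
        W = WT ++ WB].

(* Main.v *)
Require Import Defs.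
From mathcomp Require Import all_boot all_order all_algebra all_fingroup.
From mathcomp Require Import zify ring lra.

(** Let [t^+] be the next position with the letter of position [t] in the word
    of colors of the chain.  All three quivers obey one rule.  There is an arrow
    between [t] and [t^+], directed by the side on which the envelope grows at
    time [t^+].  Any other arrow joins [p < q < p^+] of adjacent colors, and
    it depends only on the sides on which the envelope grows at the two ends of
    the common life time of [p] and [q], which is the interval from [q] to
    [min(p^+, q^+)].  [net_arrows] is this rule; for signed words it is the
    definition, up to a case analysis ([signed_exchange_net]).

    Boxes.  The envelope at time [u] is an interval, and the box of [p] consists
    of all the positions of its color in that interval exactly when
    [p <= u < p^+] ([alive_chain]).  The box of [p^+] extends the box of [p] on
    the side on which the envelope grows ([next_box]), so the conditions that
    some extended box belongs to the chain say how a life ends, and those on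
    effective ends say how it begins.  What remains is a comparison of the end
    points of the envelopes at the four times [p], [q], [p^+] and [q^+]
    ([box_arrow_net]).

    Weaves.  Once the word of the half twist has been read, the part of each
    slice that has been merged is a reduced word [i_1 ... i_l] of the longest
    element, and its [k]-th strand carries the positive root
    [s_(i_1) ... s_(i_(k-1)) alpha_(i_k)].  A 4-valent vertex exchanges two
    orthogonal roots, and a 6-valent vertex turns [b, b + c, c] into
    [c, b + c, b].  The cycle of [t] is born on an outermost strand, and on
    either side the root of that strand is the simple root of the starred color
    of [t].  As [b + c] is never simple, the propagation rule sends the
    indicator of the strand with a given simple root to the indicator of the
    strand with the same root ([root_move_marks]); so the cycle stays such an
    indicator until its strand is merged, at time [t^+], and vanishes from then
    on.  In particular [t] is frozen iff [t^+] is infinite.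

    Two living cycles meet at a 6-valent vertex only when [b] and [c] are their
    simple roots, and the local intersection is then the change of the order of
    their strands ([root_move_intersection]).  The sum over a stretch of moves
    telescopes, whatever the moves are, and at both ends of the common life time
    the order is known because a strand that is born or merged is outermost
    ([comes_first_add_root]).  This gives [net_arrows] with all arrows reversed.

    About Coxeter groups this uses that the roots of a reduced word are
    nonnegative ([reduced_root_nonneg]), that minus the longest element permutes
    the simple roots ([simple_root_star]), and that the Demazure product of every
    word containing a reduced word of the longest element is the longest element
    ([demazure_longest]), so that each letter after the half twist is merged. *)

Set Implicit Arguments.
Unset Strict Implicit.
Unset Printing Implicit Defensive.

Import Order.TTheory GRing.Theory Num.Theory.

(** * Neighbouring occurrences of a letter in a word *)

Lemma head_filter_iota (P : pred nat) d a k (m := head d [seq t <- iota a k | P t]) :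
  (forall t, a <= t < a + k -> ~~ P t) /\ m = d \/
  [/\ a <= m < a + k, P m & forall t, a <= t < m -> ~~ P t].
Proof.
rewrite {}/m; elim: k a => [|k IH] a /=; first by left; split=> // t; lia.
case: ifP => [Pa|nPa] /=; first by right; split=> //; [lia | move=> t; lia].
have Pa' t : t = a -> ~~ P t by move=> ->; rewrite nPa.
have cut t : a <= t -> t = a \/ a.+1 <= t by lia.
case: (IH a.+1) => [[none ->]|[lt Pm none]]; [left; split=> // | right; split=> //].
- by move=> t /andP[/cut[/Pa'//|l1] l2]; apply: none; lia.
- by lia.
by move=> t /andP[/cut[/Pa'//|l1] l2]; apply: none; lia.
Qed.

Lemma last_filter_iota (P : pred nat) d a k (m := last d [seq t <- iota a k | P t]) :
  (forall t, a <= t < a + k -> ~~ P t) /\ m = d \/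
  [/\ a <= m < a + k, P m & forall t, m < t < a + k -> ~~ P t].
Proof.
rewrite {}/m; elim: k => [|k IH]; first by left; split=> // t; lia.
rewrite -addn1 iotaD filter_cat last_cat /=.
case: ifP => [Pa|nPa] /=; first by right; split=> //; [lia | move=> t; lia].
have Pa' t : t = a + k -> ~~ P t by move=> ->; rewrite nPa.
have cut t : t < a + (k + 1) -> t = a + k \/ t < a + k by lia.
case: IH => [[none ->]|[lt Pm none]]; [left; split=> // | right; split=> //].
- by move=> t /andP[l1 /cut[/Pa'//|l2]]; apply: none; lia.
- by lia.
by move=> t /andP[l1 /cut[/Pa'//|l2]]; apply: none; lia.
Qed.

Section Positions.

Context (n : nat) (w : seq 'I_n.+1).

Lemma next_posP k (m := next_pos w k) :
  (forall t, 0 < t <= size w -> k < t -> t < m -> letter w t != letter w k) /\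
  (m = (size w).+1 \/ [/\ 0 < m <= size w, k < m & letter w m = letter w k]).
Proof.
rewrite /m /next_pos /positions.
have [[none ->]|[lt /andP[km /eqP lm] none]] :=
  head_filter_iota (fun t => (k < t) && (letter w t == letter w k)) (size w).+1 1 (size w).
  split; last by left.
  by move=> t le kt _; have := none t; rewrite kt; apply; lia.
split; last by right; split=> //; lia.
by move=> t le kt lt'; have := none t; rewrite kt; apply; lia.
Qed.

Lemma next_pos_gt k : k <= size w -> k < next_pos w k.
Proof. by move=> le; have [_ [->|[]]] := next_posP k. Qed.

Lemma next_pos_le k : next_pos w k <= (size w).+1.
Proof. by have [_ [->|[]]] := next_posP k => //; lia. Qed.

Lemma next_pos_letter k : next_pos w k <= size w -> letter w (next_pos w k) = letter w k.
Proof. by have [_ [->|[]]] := next_posP k; rewrite ?ltnn. Qed.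

Lemma next_pos_between k t : 0 < t <= size w -> k < t < next_pos w k -> letter w t != letter w k.
Proof. by move=> le /andP[kt tn]; have [none _] := next_posP k; apply: none. Qed.

Lemma prev_posP k (m := prev_pos w k) :
  (forall t, 0 < t <= size w -> t < k -> m < t -> letter w t != letter w k) /\
  (m = 0 \/ [/\ 0 < m <= size w, m < k & letter w m = letter w k]).
Proof.
rewrite /m /prev_pos /positions.
have [[none ->]|[lt /andP[km /eqP lm] none]] :=
  last_filter_iota (fun t => (t < k) && (letter w t == letter w k)) 0 1 (size w).
  split; last by left.
  by move=> t le kt _; have := none t; rewrite kt; apply; lia.
split; last by right; split=> //; lia.
by move=> t le kt lt'; have := none t; rewrite kt; apply; lia.
Qed.

Lemma occ_geP j k (m := occ_ge w j k) :
  (forall t, 0 < t <= size w -> k <= t -> t < m -> letter w t != j) /\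
  (m = (size w).+1 \/ [/\ 0 < m <= size w, k <= m & letter w m = j]).
Proof.
rewrite /m /occ_ge /positions.
have [[none ->]|[lt /andP[km /eqP lm] none]] :=
  head_filter_iota (fun t => (k <= t) && (letter w t == j)) (size w).+1 1 (size w).
  split; last by left.
  by move=> t le kt _; have := none t; rewrite kt; apply; lia.
split; last by right; split=> //; lia.
by move=> t le kt lt'; have := none t; rewrite kt; apply; lia.
Qed.

Lemma occ_leP j k (m := occ_le w j k) :
  (forall t, 0 < t <= size w -> t <= k -> m < t -> letter w t != j) /\
  (m = 0 \/ [/\ 0 < m <= size w, m <= k & letter w m = j]).
Proof.
rewrite /m /occ_le /positions.
have [[none ->]|[lt /andP[km /eqP lm] none]] :=
  last_filter_iota (fun t => (t <= k) && (letter w t == j)) 0 1 (size w).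
  split; last by left.
  by move=> t le kt _; have := none t; rewrite kt; apply; lia.
split; last by right; split=> //; lia.
by move=> t le kt lt'; have := none t; rewrite kt; apply; lia.
Qed.

End Positions.

Definition is_right (X : side) : bool := if X is Rgt then true else false.

(** For [p < q], the number of arrows [q -> p] minus the number of arrows
    [p -> q].  In the last case the first term tells whether [p] precedes [q] in
    the left to right order when the first of the two lives ends, the second
    whether it does so when [q] is born: what grows or merges on the right is
    last in that order. *)
Definition net_arrows (n : nat) (C : 'M[int]_n.+1) (h : seq 'I_n.+1) (X : nat -> side)
    (p q : nat) : int :=
  (let nx := next_pos h in
   if (nx p <= q)%N then (if nx p == q then (if is_right (X q) then 1 else -1) else 0)
   else if C (letter h p) (letter h q) == -1 then
     (if (nx p < nx q)%N then ~~ is_right (X (nx p)) else is_right (X (nx q)))%:R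
     - (is_right (X q))%:R
   else 0)%R.

(** * Envelopes and boxes of an admissible chain *)

Section NextPrev.

Context (n : nat) (w : seq 'I_n.+1).

Lemma prev_posE x y : 0 < x <= size w -> x < y -> letter w x = letter w y ->
  (forall u, x < u < y -> letter w u != letter w y) -> y <= (size w).+1 -> prev_pos w y = x.
Proof.
move=> xr xy lxy none yr; have [np nm] := prev_posP w y; set m := prev_pos w y in np nm *.
case: (ltngtP m x) => // mx.
  by have := np x xr xy mx; rewrite lxy eqxx.
case: nm => [m0|[mr my lm]]; first by rewrite m0 in mx.
by have := none m; rewrite lm eqxx mx my => /(_ isT).
Qed.

Lemma next_posE x y : 0 < y <= size w -> x < y -> letter w y = letter w x ->
  (forall u, x < u < y -> letter w u != letter w x) -> next_pos w x = y.
Proof.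
move=> yr xy lxy none; have [np nm] := next_posP w x; set m := next_pos w x in np nm *.
case: (ltngtP m y) => // my.
  case: nm => [m0|[mr xm lm]]; first by move: my yr; rewrite m0; lia.
  by have := none m; rewrite lm eqxx my xm => /(_ isT).
by have := np y yr xy my; rewrite lxy eqxx.
Qed.

Lemma prev_next_pos y : 0 < y -> next_pos w y <= size w -> prev_pos w (next_pos w y) = y.
Proof.
move=> y0 le; have [np [E|[mr ym lm]]] := next_posP w y; first by move: le; rewrite E ltnn.
apply: prev_posE => //; [lia | move=> u uy; rewrite lm; apply: np; lia | lia].
Qed.

Lemma next_prev_pos y : y <= size w -> 0 < prev_pos w y -> next_pos w (prev_pos w y) = y.
Proof.
move=> yr le; have [np [E|[mr my lm]]] := prev_posP w y; first by move: le; rewrite E ltnn.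
apply: next_posE => //; [lia | move=> u uy; rewrite lm; apply: np; lia].
Qed.

End NextPrev.

Section Chain.

Context (n : nat) (w : seq 'I_n.+1) (ch : seq (nat * nat)).
Context (adm : admissible_chain w ch).

Local Notation r := (size w).
(* The envelope of the first t boxes starts at ea t and has t elements. *)
Let ea t := env_left ch t.
Let eb t := (ea t + t).-1.

Definition chain_letters : seq 'I_n.+1 := [seq color w ch t | t <- iota 1 (size w)].
(** The side on which the envelope grows at time [t], rather than [t + 1]. *)
Definition chain_side (t : nat) : side := LR ch t.-1.

Let h := chain_letters.
Let nx := next_pos h.
Let right t := is_right (chain_side t).

Lemma size_chain : size ch = r. Proof. by case: adm. Qed.

Lemma size_chain_letters : size h = r.
Proof. by rewrite size_map size_iota. Qed.

Lemma letter_chain t : 0 < t <= r -> letter h t = color w ch t.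
Proof.
move=> le; rewrite /letter (nth_map 0) ?size_iota; last by lia.
by rewrite nth_iota; [congr color; lia | lia].
Qed.

Lemma box_mem t : 0 < t <= r -> box ch t \in ch.
Proof. by move=> le; apply: mem_nth; rewrite size_chain; lia. Qed.

Lemma mem_box c : c \in ch -> exists2 t, 0 < t <= r & box ch t = c.
Proof.
move=> cc; exists (index c ch).+1; rewrite /box ?nth_index //=.
by rewrite -size_chain index_mem.
Qed.

Lemma box_ibox t : 0 < t <= r ->
  let: (x, y) := box ch t in [/\ 0 < x, x <= y, y <= r & letter w x = letter w y].
Proof.
move=> le; case: adm => _ /(_ _ (box_mem le)) + _.
by case: (box ch t) => x y /and4P[? ? ? /eqP].
Qed.

Lemma in_envelopeS t k : t < r ->
  in_envelope ch t.+1 k = in_envelope ch t k || ((box ch t.+1).1 <= k <= (box ch t.+1).2).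
Proof.
by move=> lt; rewrite /in_envelope (take_nth (0, 0)) ?size_chain // has_rcons orbC.
Qed.

Lemma foldr_minn_le d s x : x \in d :: s -> foldr minn d s <= x.
Proof.
elim: s x => [|y s IH] x /=; first by rewrite inE => /eqP->.
rewrite !inE => /or3P[/eqP->|/eqP->|xs]; rewrite geq_min ?leqnn // ?orbT //.
  by rewrite IH ?orbT // mem_head.
by rewrite IH ?orbT // inE xs orbT.
Qed.

Lemma foldr_minn_mem d s : foldr minn d s \in d :: s.
Proof.
elim: s => [|y s IH] /=; first exact: mem_head.
rewrite /minn; case: ifP => _; rewrite !inE ?eqxx ?orbT //.
by move: IH; rewrite inE => /orP[->|->] //; rewrite !orbT.
Qed.

(** The left end of the envelope, which is a minimum over all the boxes, is also
    the left end of the interval provided by admissibility, since every box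
    starts inside that interval. *)
Lemma envelopeP t : 0 < t <= r ->
  [/\ forall k, in_envelope ch t k = (ea t <= k <= eb t), 0 < ea t, eb t <= r &
      box ch t = box_l w (ea t) (eb t) \/ box ch t = box_r w (ea t) (eb t)].
Proof.
move=> le; have [sz ib /(_ t le)[a [b [env ab bx]]]] := adm.
have ch0 : box ch 1 \in take t ch.
  have lt : 0 < size (take t ch) by rewrite size_take sz; case: (ltnP t r); lia.
  have -> : box ch 1 = nth (0, 0) (take t ch) 0 by rewrite nth_take //; lia.
  exact: mem_nth.
have a_min c : c \in take t ch -> a <= c.1.
  move=> ct; have /and4P[_ c12 _ _] := ib c (mem_take ct).
  have : in_envelope ch t c.1 by apply/hasP; exists c; rewrite ?leqnn.
  by rewrite env => /andP[].
have Da : ea t = a.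
  apply/eqP; rewrite eqn_leq; apply/andP; split; last first.
    have := foldr_minn_mem (box ch 1).1 [seq c.1 | c <- take t ch].
    by rewrite inE => /orP[/eqP|/mapP[c ct]] E; rewrite /ea /env_left E a_min.
  have /hasP[c ct /andP[c1 _]] : in_envelope ch t a by rewrite env leqnn; lia.
  by apply: leq_trans c1; apply: foldr_minn_le; rewrite inE map_f ?orbT.
have Db : eb t = b by rewrite /eb Da -ab.
rewrite Db Da; split=> //.
  have /hasP[c ct /andP[c1 _]] : in_envelope ch t a by rewrite env leqnn; lia.
  by have /and4P[c0 _ _ _] := ib c (mem_take ct); exact: leq_trans c0 c1.
have /hasP[c ct /andP[_ c2]] : in_envelope ch t b by rewrite env leqnn; lia.
by have /and4P[_ _ cr _] := ib c (mem_take ct); apply: leq_trans c2 cr.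
Qed.

Lemma envelope_size t : 0 < t <= r -> (eb t).+1 = ea t + t.
Proof. by rewrite /eb; case: t => // t _; rewrite addnS. Qed.

Lemma envelope_step t : 0 < t -> t < r ->
  if right t.+1 then ea t.+1 = ea t /\ eb t.+1 = (eb t).+1
  else (ea t.+1).+1 = ea t /\ eb t.+1 = eb t.
Proof.
move=> t0 tr.
have [env a0 _ _] := @envelopeP t ltac:(lia).
have [env' _ _ _] := @envelopeP t.+1 ltac:(lia).
have sz := @envelope_size t ltac:(lia).
have sz' := @envelope_size t.+1 ltac:(lia).
have sub k : ea t <= k <= eb t -> ea t.+1 <= k <= eb t.+1.
  by move=> kt; rewrite -env' in_envelopeS // env kt.
have := sub (ea t) ltac:(lia); have := sub (eb t) ltac:(lia).
rewrite /right /is_right /chain_side /LR /= t0 -/(ea t.+1) -/(ea t) /=.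
by case: (ltnP (ea t.+1) (ea t)) => /=; lia.
Qed.

Lemma envelope_mono t u : 0 < t <= u -> u <= r -> ea u <= ea t /\ eb t <= eb u.
Proof.
case/andP=> t0; elim: u => [|u IH]; first by lia.
rewrite leq_eqVlt => /orP[/eqP-> _|] //.
rewrite ltnS => tu ur; have [] := IH tu ltac:(lia).
by have := @envelope_step u ltac:(lia) ur; case: ifP; lia.
Qed.

(** Both forms of a box, [box_l] and [box_r], collect all the positions of their
    color in the envelope.  This is all that the sequel needs of them. *)
Lemma chain_box t : 0 < t <= r -> let: (x, y) := box ch t in
  [/\ ea t <= x, x <= y, y <= eb t, letter w y = letter w x
    & forall u, ea t <= u <= eb t -> letter w u = letter w x -> x <= u <= y].
Proof.
move=> le; have [env a0 br bx] := envelopeP le; have := box_ibox le.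
have sz := envelope_size le.
case: (box ch t) bx => x y bx [x0 xy yr lxy].
case: bx => -[].
  move=> Dx Dy; have := occ_leP w (letter w (ea t)) (eb t).
  rewrite -Dy => -[none [|[_ yb ly]]]; first by lia.
  split; [lia | lia | lia | by [] |].
  move=> u ue lu; rewrite Dx; apply/andP; split; first by lia.
  rewrite leqNgt; apply/negP => yu.
  by have := none u ltac:(lia) ltac:(lia) yu; rewrite lu Dx eqxx.
move=> Dx Dy; have := occ_geP w (letter w (eb t)) (ea t).
rewrite -Dx => -[none [|[_ xa lx]]]; first by lia.
split; [lia | lia | lia | by [] |].
move=> u ue lu; rewrite Dy; apply/andP; split; last by lia.
rewrite leqNgt; apply/negP => ux.
by have := none u ltac:(lia) ltac:(lia) ux; rewrite lu lx eqxx.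
Qed.

(** The new position of the envelope lies in the new box, and as it is an end of
    the envelope it is an end of the box, even when the box was given in the form
    that fits the other side. *)
Lemma chain_box_end t : 0 < t <= r -> let: (x, y) := box ch t in
  if right t then y = eb t else x = ea t.
Proof.
move=> le; have := chain_box le; case Db : (box ch t) => [x y] [ax xy yb _ _].
case: t le Db ax yb => // -[|t] le Db ax yb.
  have := envelope_size le; rewrite /right /is_right /chain_side /LR /=; lia.
have := @envelope_step t.+1 ltac:(lia) ltac:(lia).
have [env _ _ _] := @envelopeP t.+1 ltac:(lia).
have [env' _ _ _] := @envelopeP t.+2 ltac:(lia).
have sz := @envelope_size t.+1 ltac:(lia).
case: ifP => _ [E1 E2].
  have : in_envelope ch t.+2 (eb t.+2) by rewrite env'; lia.
  by rewrite in_envelopeS; [rewrite env Db /=; lia | lia].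
have : in_envelope ch t.+2 (ea t.+2) by rewrite env'; lia.
by rewrite in_envelopeS; [rewrite env Db /=; lia | lia].
Qed.

Lemma effective_endE t : 0 < t <= r ->
  effective_end w ch t = if right t then eb t else ea t.
Proof.
move=> le; rewrite /effective_end /positions.
set e := if _ then _ else _.
have De : e = if right t then eb t else ea t by [].
clearbody e.
have P k : in_envelope ch t k && ~~ in_envelope ch t.-1 k = (k == e).
  case: t le De => // -[|t] le De.
    have -> : in_envelope ch 1.-1 k = false by rewrite /in_envelope take0.
    have [-> _ _ _] := envelopeP le; have := envelope_size le.
    by rewrite andbT De => ?; case: (right 1); apply/idP/eqP; lia.
  have := @envelope_step t.+1 ltac:(lia) ltac:(lia).
  have [-> _ _ _] := @envelopeP t.+1 ltac:(lia).
  have [-> _ _ _] := @envelopeP t.+2 ltac:(lia).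
  have := @envelope_size t.+1 ltac:(lia).
  by move=> ?; rewrite De; case: (right t.+2) => -[E1 E2]; apply/idP/eqP; lia.
have [_ a0 br _] := envelopeP le; have sz := envelope_size le.
have er : 0 < e <= r by rewrite De; case: (right t); lia.
have [[none _]|[_ + _]] := head_filter_iota
  (fun k => in_envelope ch t k && ~~ in_envelope ch t.-1 k) 0 1 r.
  by have := none e ltac:(lia); rewrite P eqxx.
by rewrite P => /eqP.
Qed.

Lemma colorE t : color w ch t = letter w (box ch t).1. Proof. by []. Qed.

Lemma next_chain_gt p : p <= r -> p < nx p.
Proof. by move=> le; rewrite /nx next_pos_gt // size_chain_letters. Qed.

Lemma next_chain_le p : nx p <= r.+1.
Proof. by rewrite -size_chain_letters next_pos_le. Qed.

Lemma next_chain_color p : 0 < p -> nx p <= r -> color w ch (nx p) = color w ch p.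
Proof.
move=> p0; rewrite /nx; have [_ [->|[]]] := next_posP h p; rewrite size_chain_letters ?ltnn //.
by move=> /andP[m0 mr] pm + _; rewrite !letter_chain //; lia.
Qed.

Lemma next_chain_min p u : 0 < p < u -> u <= r -> color w ch u = color w ch p -> nx p <= u.
Proof.
move=> pu ur cu; rewrite leqNgt; apply/negP => un; have [none _] := next_posP h p.
have := none u; rewrite size_chain_letters !letter_chain; [|lia|lia].
by rewrite cu eqxx => H; move: (H ltac:(lia) ltac:(lia) un).
Qed.

(** The box of [p] is the set of all positions of its color in the envelope at
    time [u] as long as no further position of that color has been absorbed; the
    first one absorbed is a neighbour of the box. *)
Lemma alive_chain p u : 0 < p <= u -> u <= r -> let: (x, y) := box ch p in
  (u < nx p) = (prev_pos w x < ea u) && (eb u < next_pos w y).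
Proof.
move=> pu ur; have le : 0 < p <= r by lia.
have := chain_box le; have := box_ibox le; have := colorE p.
case Db : (box ch p) => [x y] /= cp [x0 xy yr lxy] [ax _ yb lyx inb].
have [pnone pm] := prev_posP w x; have [nnone nm] := next_posP w y.
set xm := prev_pos w x in pnone pm *; set yp := next_pos w y in nnone nm *.
have [_ a0 br _] := envelopeP le; have sz := envelope_size le.
apply/idP/idP => [un|].
  have {un} : forall v, p < v <= u -> color w ch v != letter w x.
    move=> v pv; rewrite -cp; apply/eqP => /(next_chain_min _ _) H.
    by have := H ltac:(lia) ltac:(lia); lia.
  elim: u pu ur => [|u IH] pu ur none; first by lia.
  have [Dp|ltpu] : p = u.+1 \/ p <= u by lia.
    rewrite -Dp; apply/andP; split.
      case: pm => [->//|[xmr xmx lxm]]; rewrite ltnNge; apply/negP => axm.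
      by have := inb xm ltac:(lia) lxm; lia.
    case: nm => [->//|[ypr yyp lyp]]; rewrite ltnNge; apply/negP => ybp.
    by have := inb yp ltac:(lia) ltac:(congruence); lia.
  have /andP[xa by_] := IH ltac:(lia) ltac:(lia) (fun v pv => none v ltac:(lia)).
  have := none u.+1 ltac:(lia); rewrite colorE.
  have := @chain_box u.+1 ltac:(lia); have := @chain_box_end u.+1 ltac:(lia).
  have [_ a0' br' _] := @envelopeP u.+1 ltac:(lia).
  have := @envelope_step u ltac:(lia) ur.
  case: (box ch u.+1) => x' y' /=; case: ifP => _ [E1 E2] e [_ _ _ l' _] ne.
    rewrite E1 xa /= E2 ltn_neqAle by_ andbT.
    apply/eqP => E; case/eqP: ne; rewrite -l' e E2 E lxy.
    by case: nm => [Ey|[]//]; move: br'; rewrite E2 E Ey; lia.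
  rewrite E2 by_ andbT ltn_neqAle -ltnS E1 xa andbT.
  apply/eqP => E; case/eqP: ne; rewrite e -E.
  by case: pm => [Ex|[]//]; move: a0'; rewrite -E Ex.
move=> /andP[xa by_]; rewrite ltnNge; apply/negP => nu.
have gt := @next_chain_gt p ltac:(lia); set v := nx p in nu gt.
have := @next_chain_color p ltac:(lia) ltac:(lia); rewrite -/v !colorE Db /=.
have := @chain_box v ltac:(lia); have := @chain_box_end v ltac:(lia).
have [_ a0' br' _] := @envelopeP v ltac:(lia).
have [m1 m2] := @envelope_mono p v.-1 ltac:(lia) ltac:(lia).
have [m3 m4] := @envelope_mono v u ltac:(lia) ltac:(lia).
have := @envelope_step v.-1 ltac:(lia) ltac:(lia).
rewrite prednK; last by lia.
case: (box ch v) => x' y' /=; case: ifP => _ [E1 E2] e [_ _ _ l' _] lx'.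
  have := nnone y' ltac:(lia) ltac:(lia) ltac:(lia).
  by rewrite l' lx' lxy eqxx.
have := pnone x' ltac:(lia) ltac:(lia) ltac:(lia).
by rewrite lx' eqxx.
Qed.

Lemma next_box p : 0 < p -> nx p <= r -> let: (x, y) := box ch p in
  if right (nx p)
  then [/\ box ch (nx p) = (x, next_pos w y), eb (nx p) = next_pos w y
         & prev_pos w x < ea (nx p)]
  else [/\ box ch (nx p) = (prev_pos w x, y), ea (nx p) = prev_pos w x
         & eb (nx p) < next_pos w y].
Proof.
move=> p0 nr; have gt : p < nx p.
  rewrite /nx; have [_ [E|[]//]] := next_posP h p.
  by move: nr; rewrite /nx E size_chain_letters ltnn.
have le : 0 < p <= r by lia.
have := chain_box le; have := box_ibox le; have := next_chain_color p0 nr.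
have := @alive_chain p (nx p).-1 ltac:(lia) ltac:(lia).
have := @alive_chain p (nx p) ltac:(lia) nr; rewrite !colorE ltnn prednK; last by lia.
rewrite leqnn; case: (box ch p) => x y /= dead /esym/andP[xa by_] cn.
have [pnone pm] := prev_posP w x; have [nnone nm] := next_posP w y.
set xm := prev_pos w x in dead xa pnone pm *; set yp := next_pos w y in dead by_ nnone nm *.
move=> [x0 xy yr lxy] [ax _ yb _ _].
have := @envelope_step (nx p).-1 ltac:(lia) ltac:(lia).
have := @chain_box (nx p) ltac:(lia); have := @chain_box_end (nx p) ltac:(lia).
have [_ a0' br' _] := @envelopeP (nx p) ltac:(lia).
have [m1 m2] := @envelope_mono p (nx p) ltac:(lia) nr.
rewrite prednK; last by lia.
move: cn; case: (box ch (nx p)) => x' y' /= cn; case: ifP => _ e [ax' x'y' y'b l' inb] [E1 E2].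
  have xa' : xm < ea (nx p) by rewrite E1.
  have Dyp : eb (nx p) = yp by move: dead; rewrite xa' /=; lia.
  have xx' : x = x'.
    have := inb x ltac:(lia) (esym cn); case: (ltngtP x' x) => [lt _|gt'|//]; last by lia.
    by have := pnone x' ltac:(lia) lt ltac:(lia); rewrite cn eqxx.
  by rewrite xx' e Dyp.
have by' : eb (nx p) < yp by rewrite E2.
have Dxm : ea (nx p) = xm by move: dead; rewrite by' andbT; lia.
have yy' : y = y'.
  have := inb y ltac:(lia) ltac:(congruence); case: (ltngtP y y') => [lt _|gt'|//]; last by lia.
  have := nnone y' ltac:(lia) lt ltac:(lia).
  by rewrite l' cn lxy eqxx.
by rewrite yy' e Dxm.
Qed.

(** If [p < q] had the same box, then [p^+ <= q], so the box of [p] would no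
    longer exhaust its color at time [q], while the box of [q] does. *)
Lemma box_inj p q : 0 < p <= r -> 0 < q <= r -> box ch p = box ch q -> p = q.
Proof.
wlog pq : p q / p < q.
  by move=> H lp lq E; case: (ltngtP p q) => // lt; [apply: H | apply/esym/H].
move=> lp lq E; have := @next_chain_min p q ltac:(lia) ltac:(lia).
rewrite !colorE E => /(_ erefl) nq; exfalso.
have := @alive_chain q q ltac:(lia) ltac:(lia).
have := @alive_chain p q ltac:(lia) ltac:(lia).
rewrite E; case: (box ch q) => x y <-.
have := @next_chain_gt q ltac:(lia); lia.
Qed.

(** The box extended to the right belongs to the chain only if it is the box of
    [p^+]: had the left neighbour been absorbed first, every later box of this
    color would contain that neighbour. *)
Lemma mem_extend_right p : 0 < p <= r -> let: (x, y) := box ch p in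
  ((x, next_pos w y) \in ch) = (nx p <= r) && right (nx p).
Proof.
move=> le; have p0 : 0 < p by lia.
have := @next_box p p0; have := chain_box le; have := box_ibox le; have := colorE p.
have := @alive_chain p p ltac:(lia) ltac:(lia); rewrite next_chain_gt; last by lia.
case Db : (box ch p) => [x y] /= /esym/andP[xa by_] cp [x0 xy yr lxy] [ax _ yb _ _] nb.
apply/idP/andP => [/mem_box[v lev Dv]|[nr rn]]; last first.
  by move: (nb nr); rewrite rn => -[<- _ _]; apply: box_mem; have := @next_chain_gt p; lia.
have := chain_box lev; have := box_ibox lev; have := colorE v.
rewrite Dv /= => cv [_ _ ypr lyp] [axv _ ybv _ inb].
have pv : p < v.
  by rewrite ltnNge; apply/negP => vp; have := @envelope_mono v p ltac:(lia) ltac:(lia); lia.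
have nv : nx p <= v by apply: next_chain_min; rewrite ?cv ?cp //; lia.
have nr : nx p <= r by lia.
split=> //; apply/idPn => /negbTE nR; move: (nb nr); rewrite nR => -[Dm Ea _].
have gt := @next_chain_gt p ltac:(lia).
have [_ a0 _ _] := @envelopeP (nx p) ltac:(lia).
have := @envelope_mono (nx p) v ltac:(lia) ltac:(lia).
have [_ [Ez|[_ xmx lxm]]] := prev_posP w x; first by rewrite Ez in Ea; lia.
have := inb (prev_pos w x); rewrite lxm => /(_ _ erefl) H [m1 m2].
have := @envelope_mono p v ltac:(lia) ltac:(lia).
by move: (H ltac:(lia)); lia.
Qed.

Lemma mem_extend_left p : 0 < p <= r -> let: (x, y) := box ch p in
  ((prev_pos w x, y) \in ch) = (nx p <= r) && ~~ right (nx p).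
Proof.
move=> le; have p0 : 0 < p by lia.
have := @next_box p p0; have := chain_box le; have := box_ibox le; have := colorE p.
have := @alive_chain p p ltac:(lia) ltac:(lia); rewrite next_chain_gt; last by lia.
case Db : (box ch p) => [x y] /= /esym/andP[xa by_] cp [x0 xy yr lxy] [ax _ yb _ _] nb.
apply/idP/andP => [/mem_box[v lev Dv]|[nr /negbTE rn]]; last first.
  by move: (nb nr); rewrite rn => -[<- _ _]; apply: box_mem; have := @next_chain_gt p; lia.
have := chain_box lev; have := box_ibox lev; have := colorE v.
rewrite Dv /= => cv [xm0 _ _ lxm] [axv _ ybv _ inb].
have pv : p < v.
  by rewrite ltnNge; apply/negP => vp; have := @envelope_mono v p ltac:(lia) ltac:(lia); lia.
have nv : nx p <= v by apply: next_chain_min; rewrite ?cv ?cp //; [lia | lia | rewrite lxm lxy].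
have nr : nx p <= r by lia.
split=> //; apply/negP => nR; move: (nb nr); rewrite nR => -[Dm Eb _].
have gt := @next_chain_gt p ltac:(lia).
have [_ _ br _] := @envelopeP (nx p) ltac:(lia).
have := @envelope_mono (nx p) v ltac:(lia) ltac:(lia).
have [_ [Ez|[_ yyp lyp]]] := next_posP w y; first by rewrite Ez in Eb; lia.
have := inb (next_pos w y); rewrite lyp lxm => /(_ _ erefl) H [m1 m2].
have := @envelope_mono p v ltac:(lia) ltac:(lia).
by move: (H ltac:(lia)); lia.
Qed.

(** A frozen box contains all the occurrences of its color in the word, which
    means that it is still alive at the final time. *)
Lemma box_frozenE p : 0 < p <= r -> box_frozen w ch p = (r < nx p).
Proof.
move=> le; rewrite /box_frozen.
have := @alive_chain p r ltac:(lia) (leqnn _); have := chain_box le; have := box_ibox le.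
case Db : (box ch p) => [x y] [x0 xy yr lxy] _ ->.
have [env a0 br _] := @envelopeP r ltac:(lia); have sz := @envelope_size r ltac:(lia).
have [Ea Eb] : ea r = 1 /\ eb r = r by lia.
rewrite Ea Eb.
have [pnone pm] := prev_posP w x; have [nnone nm] := next_posP w y.
have [gnone gm] := occ_geP w (letter w x) 1; have [lnone lm] := occ_leP w (letter w x) r.
apply/existsP/andP => [[i /eqP[Ex Ey]]|[xm yp]].
  have := occ_geP w i 1; have := occ_leP w i r.
  rewrite -Ex -Ey => -[non2 [|[_ _ ly]]]; first by lia.
  case=> [non1 [|[_ _ lx]]]; first by lia.
  split; rewrite ltnNge; apply/negP => bad.
    case: pm => [E|[xr xx lm']]; first by lia.
    by have := non1 (prev_pos w x) ltac:(lia) ltac:(lia) xx; rewrite lm' lx eqxx.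
  case: nm => [E|[xr xx lm']]; first by lia.
  by have := non2 (next_pos w y) ltac:(lia) ltac:(lia) xx; rewrite lm' ly eqxx.
exists (letter w x); apply/eqP; congr pair.
  case: gm => [E|[_ g1 lg]].
    by have := gnone x ltac:(lia) ltac:(lia) ltac:(lia); rewrite eqxx.
  apply/eqP; rewrite eqn_leq; apply/andP; split; rewrite leqNgt; apply/negP => bad.
    by have := pnone (occ_ge w (letter w x) 1) ltac:(lia) bad ltac:(lia); rewrite lg eqxx.
  by have := gnone x ltac:(lia) ltac:(lia) bad; rewrite eqxx.
case: lm => [E|[_ g1 lg]].
  by have := lnone x ltac:(lia) ltac:(lia) ltac:(lia); rewrite eqxx.
apply/eqP; rewrite eqn_leq; apply/andP; split; rewrite leqNgt; apply/negP => bad.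
  by have := lnone y ltac:(lia) ltac:(lia) bad; rewrite lxy eqxx.
have := nnone (occ_le w (letter w x) r) ltac:(lia) bad ltac:(lia).
by rewrite lg lxy eqxx.
Qed.

Context (C : 'M[int]_n.+1) (C_diag : forall i, C i i = 2%R).
Context (C_sym : forall i j, C i j = C j i).

Lemma extend_right_next p q : 0 < p <= r -> 0 < q <= r ->
  let: (x, y) := box ch p in let: (x', y') := box ch q in
  (x == x') && (y' == prev_pos w y) = (p == nx q) && right p.
Proof.
move=> lp lq; have mR := mem_extend_right lq; have nb := @next_box q ltac:(lia).
have inj v := @box_inj p v lp; have := box_ibox lp; have := box_ibox lq.
have bp := box_mem lp.
case: (box ch q) mR nb inj => x' y' mR nb inj [x0' xy' yr' lxy'].
case Db: (box ch p) bp inj => [x y] bp inj [x0 xy yr lxy].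
apply/idP/idP => [/andP[/eqP Dx /eqP Dy]|/andP[/eqP Dp Rp]].
  have Dy' : next_pos w y' = y by rewrite Dy next_prev_pos //; lia.
  move: mR; rewrite Dy' -Dx bp => /esym/andP[nr Rn]; move: (nb nr); rewrite Rn => -[Dn _ _].
  have -> : p = nx q.
    apply: inj; first by have := @next_chain_gt q; lia.
    by rewrite Dn Dy' Dx.
  by rewrite eqxx.
have nr : nx q <= r by lia.
move: (nb nr); rewrite -/nx -Dp Db Rp => -[[-> Dy] _ _].
rewrite eqxx Dy prev_next_pos ?eqxx //; lia.
Qed.

Lemma extend_left_next p q : 0 < p <= r -> 0 < q <= r ->
  let: (x, y) := box ch p in let: (x', y') := box ch q in
  (y == y') && (x' == prev_pos w x) = (q == nx p) && ~~ right q.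
Proof.
move=> lp lq; have mL := mem_extend_left lp; have nb := @next_box p ltac:(lia).
have inj v := @box_inj q v lq; have := box_ibox lp; have := box_ibox lq.
have bq := box_mem lq.
case: (box ch p) mL nb => x y mL nb.
case Db: (box ch q) bq inj => [x' y'] bq inj [x0' xy' yr' lxy'] [x0 xy yr lxy].
apply/idP/idP => [/andP[/eqP Dy /eqP Dx]|/andP[/eqP Dq /negbTE Rq]].
  move: mL; rewrite -Dx Dy bq => /esym/andP[nr /negbTE Rn]; move: (nb nr); rewrite Rn => -[Dn _ _].
  have Dq : q = nx p.
    apply: inj; first by have := @next_chain_gt p; lia.
    by rewrite Dn -Dx Dy.
  by rewrite Dq eqxx Rn.
have nr : nx p <= r by lia.
move: (nb nr); rewrite -/nx -Dq Db Rq => -[[-> ->] _ _].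
by rewrite !eqxx.
Qed.

Lemma box_arrow_self p : 0 < p <= r -> box_arrow C w ch p p = false.
Proof.
move=> lp; have := extend_right_next lp lp; have := extend_left_next lp lp.
rewrite /box_arrow; have gt := @next_chain_gt p ltac:(lia).
case: (box ch p) => x y -> ->; rewrite (ltn_eqF gt) /=.
by rewrite C_diag.
Qed.

(** At the birth of a box, on the right if [R] holds: the envelope extends from
    [a] to [b], the box from [x] to [y], its neighbours of the same color are
    [xm] and [yp], and its effective end is [z]. *)
Definition box_facts (a b x y xm yp z : nat) (R : bool) : Prop :=
  [/\ 0 < a <= x, x <= y, y <= b <= r, xm < a /\ b < yp <= r.+1
    & if R then y = b /\ z = b else x = a /\ z = a].

Lemma box_factsP t : 0 < t <= r -> let: (x, y) := box ch t in
  box_facts (ea t) (eb t) x y (prev_pos w x) (next_pos w y) (effective_end w ch t) (right t).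
Proof.
move=> lt; have := chain_box lt; have := chain_box_end lt; have := box_ibox lt.
have := @alive_chain t t ltac:(lia) ltac:(lia); rewrite next_chain_gt; last by lia.
have [_ a0 br _] := envelopeP lt; rewrite effective_endE //.
case: (box ch t) => x y /esym/andP[xa by_] [x0 xy yr lxy] e [ax _ yb _ _].
have yp : next_pos w y <= r.+1 by have [_ [->|[]]] := next_posP w y; lia.
by split; try lia; case: (right t) e.
Qed.

Lemma bool_diff_eq (b c : bool) :
  (b%:R - c%:R == -1 :> int)%R = ~~ b && c /\ (b%:R - c%:R == 1 :> int)%R = b && ~~ c.
Proof. by case: b; case: c. Qed.

(** The last four alternatives in [box_arrow] combine an end and a beginning of
    the common life of the two boxes.  In the first two of them it ends when the
    source is extended to the right, in the other two when the target is extended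
    to the left.  In the first and the last it begins with the birth of the source
    on the left, in the middle ones with the birth of the target on the right.
    A single alternative is weaker than this, because it does not compare the two
    moments of extension, but in the additional situations a different one of the
    four holds. *)
Lemma box_arrow_net p q : 0 < p < q -> q <= r -> (nx p <= r) || (nx q <= r) ->
  box_arrow C w ch p q = (net_arrows C h chain_side p q == (-1)%R) /\
  box_arrow C w ch q p = (net_arrows C h chain_side p q == 1%R).
Proof.
move=> pq qr nf; have lp : 0 < p <= r by lia. have lq : 0 < q <= r by lia.
have gp := @next_chain_gt p ltac:(lia); have gq := @next_chain_gt q ltac:(lia).
have leP := next_chain_le p; have leQ := next_chain_le q.
have [m1 m2] := @envelope_mono p q ltac:(lia) qr.
have szp := envelope_size lp; have szq := envelope_size lq.
have monoPq : nx p <= q -> _ := fun le => @envelope_mono (nx p) q ltac:(lia) qr.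
have monoqP : q <= nx p -> nx p <= r -> _ := fun le => @envelope_mono q (nx p) ltac:(lia).
have monoPQ : nx p <= nx q -> nx q <= r -> _ := fun le => @envelope_mono (nx p) (nx q) ltac:(lia).
have monoQP : nx q <= nx p -> nx p <= r -> _ := fun le => @envelope_mono (nx q) (nx p) ltac:(lia).
have monoqQ : nx q <= r -> _ := @envelope_mono q (nx q) ltac:(lia).
have alpq := @alive_chain p q ltac:(lia) qr.
have alpQ : nx q <= r -> _ := @alive_chain p (nx q) ltac:(lia).
have alqP : q <= nx p -> nx p <= r -> _ := fun le => @alive_chain q (nx p) ltac:(lia).
have nbp := @next_box p ltac:(lia); have nbq := @next_box q ltac:(lia).
have npq : (p == nx q) = false by lia.
have := extend_right_next lp lq; have := extend_left_next lp lq.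
have := extend_right_next lq lp; have := extend_left_next lq lp.
have := box_factsP lp; have := box_factsP lq.
have := mem_extend_right lp; have := mem_extend_right lq.
have := mem_extend_left lp; have := mem_extend_left lq.
have cP : nx p <= r -> _ := @next_chain_color p ltac:(lia).
have cQ : nx q <= r -> _ := @next_chain_color q ltac:(lia).
have cp := colorE p; have cq := colorE q; have := box_ibox lp; have := box_ibox lq.
have lhp := letter_chain lp; have lhq := letter_chain lq.
rewrite /box_arrow /net_arrows -/nx lhp lhq -!/(right _) cp cq.
case: (box ch p) nbp alpq alpQ cp => x y nbp alpq alpQ cp.
case: (box ch q) nbq alqP cq => x' y' nbq alqP cq /=.
rewrite /= in cp cq.
move=> [x0' _ _ lxy'] [x0 _ _ lxy] mLq mLp mRq mRp fq fp.
rewrite mLq mLp mRq mRp => e1 e2 e3 e4; rewrite e1 e2 e3 e4 {e1 e2 e3 e4 mLq mLp mRq mRp}.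
rewrite npq (C_sym (letter w x') (letter w x)) [q == nx p]eq_sym /= ?orbF.
have diff : C (letter w x) (letter w x') = (-1)%R -> letter w x <> letter w x'.
  by move=> E1 E2; move: E1; rewrite E2 C_diag.
have [Dq|nDq] := eqVneq (nx p) q.
  have -> : C (letter w x) (letter w x') == (-1)%R = false.
    by apply/eqP => /diff; rewrite -cp -cq -Dq cP // Dq.
  by rewrite Dq leqnn /= ?orbF; case: (right q).
have [Cpq|nC] /= := eqVneq (C (letter w x) (letter w x')) (-1)%R; last by case: ifP.
have {diff} lxx := diff Cpq.
have far u v : letter w u = letter w x -> letter w v = letter w x' -> u <> v.
  by move=> lu lv E; apply: lxx; rewrite -lu E.
have PQ : nx p <= r -> nx p <> nx q.
  move=> nr E; apply: lxx; rewrite -cp -cq.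
  by rewrite -(cP nr) E cQ // -E.
(* How the life of each box ends. *)
have fP : nx p <= r -> if right (nx p) then eb (nx p) = next_pos w y /\ prev_pos w x < ea (nx p)
    else ea (nx p) = prev_pos w x /\ eb (nx p) < next_pos w y.
  by move/nbp; case: ifP => _ [].
have fQ : nx q <= r -> if right (nx q) then eb (nx q) = next_pos w y' /\ prev_pos w x' < ea (nx q)
    else ea (nx q) = prev_pos w x' /\ eb (nx q) < next_pos w y'.
  by move/nbq; case: ifP => _ [].
have d1 := far x x' erefl erefl.
have d2 := far y y' (esym lxy) (esym lxy').
(* From here on only inequalities between natural numbers matter: the words and
   the chain are forgotten. *)
move: fp fq fP fQ alpq alpQ alqP monoPq monoqP monoPQ monoQP monoqQ PQ nf nDq.
clear nbp nbq far lxx cp cq cP cQ lhp lhq lxy lxy' Cpq npq.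
rewrite -/nx -!/(ea _) -!/(eb _) -!/(right _).
move: (prev_pos w x) (prev_pos w x') (next_pos w y) (next_pos w y') => xm xm' yp yp'.
move: (effective_end w ch p) (effective_end w ch q) => zp zq.
move: (ea p) (eb p) (ea q) (eb q) (ea (nx p)) (eb (nx p)) (ea (nx q)) (eb (nx q)) szp szq m1 m2.
move: (right p) (right q) (right (nx p)) (right (nx q)) => Rp Rq RP RQ.
move: (nx p) (nx q) gp gq leP leQ => P Q gp gq leP leQ.
move=> ap bp aq bq aP bP aQ bQ szp szq m1 m2.
move=> [fp1 fp2 fp3 [fp4 fp5] fp6] [fq1 fq2 fq3 [fq4 fq5] fq6] fP fQ.
move=> alpq alpQ alqP monoPq monoqP monoPQ monoQP monoqQ PQ nf nDq.
clear lp lq ea eb h nx right.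
have notr (b1 b2 b3 b4 : bool) : ~ b1 -> ~ b2 -> ~ b3 -> ~ b4 -> [|| b1, b2, b3 | b4] = false.
  by move=> h1 h2 h3 h4; apply/negbTE/negP => /or4P[].
have or1 (b1 b2 b3 b4 : bool) : b1 -> [|| b1, b2, b3 | b4] = true by case: b1.
have or3 (b1 b2 b3 b4 : bool) : b3 -> [|| b1, b2, b3 | b4] = true by case: b3; rewrite ?orbT.
have or2 (b1 b2 b3 b4 : bool) : b2 -> [|| b1, b2, b3 | b4] = true by case: b2; rewrite ?orbT.
have or4 (b1 b2 b3 b4 : bool) : b4 -> [|| b1, b2, b3 | b4] = true by case: b4; rewrite ?orbT.
(* If p dies before the birth of q, then none of the conditions holds. *)
case: (leqP P q) => [Pq|qP].
  have PR : P <= r by apply: leq_trans qr.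
  have {}fP := fP PR; have {}monoPq := monoPq Pq.
  rewrite PR !andTb -[(0 == -1)%R]/false -[(0 == 1)%R]/false.
  clear monoqP alqP monoPQ monoQP nf PQ alpQ monoqQ.
  case: (leqP Q r) fQ => [QR /(_ isT) fQ|_ _]; split; apply: notr;
    case: Rp fp6 => fp6; case: Rq fq6 => fq6; case: RP fP => fP //=; lia.
clear monoPq; have {}alpq : xm < aq /\ bq < yp by apply/andP; rewrite -alpq.
have {}alqP := alqP (ltnW qP); have {}monoqP := monoqP (ltnW qP).
have [-> ->] := bool_diff_eq (if P < Q then ~~ RP else RQ) Rq.
(* Equal next positions would have the two distinct colors, unless they are both
   infinite. *)
case: (ltngtP P Q) => cmp; last by exfalso; move: nf PQ; rewrite cmp orbb => QR /(_ QR).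
  have PR : P <= r by lia.
  have {}fP := fP PR; have {}monoqP := monoqP PR.
  have {}alqP : xm' < aP /\ bP < yp' by apply/andP; rewrite -alqP.
  have {monoPQ} monoPQ := monoPQ (ltnW cmp).
  rewrite PR !andTb; clear monoQP PQ nf alpQ monoqQ gp gq leP leQ cmp qP nDq PR.
  move: (Q <= r) fQ monoPQ => QR fQ monoPQ.
  case: RP fP => fP; case: Rq fq6 => fq6; split.
  (* The common life begins with the birth of q and ends with the extension of p:
     the second of the four alternatives is the condition for p -> q, and the last
     one that for q -> p. *)
  - by apply: or2; lia.
  - by apply: notr => /=; lia.
  - by apply: notr => /=; lia.
  - by apply: notr => /=; lia.
  - by apply: notr => /=; lia.
  - by apply: notr => /=; lia.
  - by apply: notr => /=; lia.
  - by apply: or4; lia.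
have QR : Q <= r by lia.
have {}fQ := fQ QR; have {}monoqQ := monoqQ QR.
have {}alpQ : xm < aQ /\ bQ < yp by apply/andP; rewrite -alpQ.
have {monoQP} monoQP := monoQP (ltnW cmp).
rewrite QR !andTb; clear monoPQ PQ nf alqP monoqP gp gq leP leQ cmp qP nDq QR.
move: (P <= r) fP monoQP => PR fP monoQP.
case: RQ fQ => fQ; case: Rq fq6 => fq6; split.
(* Here it ends with the extension of q: the third alternative is the condition
   for p -> q, and the first one that for q -> p. *)
- by apply: notr => /=; lia.
- by apply: notr => /=; lia.
- by apply: notr => /=; lia.
- by apply: or1; lia.
- by apply: or3; lia.
- by apply: notr => /=; lia.
- by apply: notr => /=; lia.
- by apply: notr => /=; lia.
Qed.

End Chain.

Local Open Scope ring_scope.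

(** * Roots, reduced words and the Demazure product *)

Section Coxeter.

Context (n : nat) (C : 'M[int]_n.+1).
Context (C_diag : forall i, C i i = 2).
Context (C_sym : forall i j, C i j = C j i).
Context (C_off : forall i j, i != j -> C i j = 0 \/ C i j = -1).

Notation alpha := (@simple_root n).
Notation vec := 'cV[int]_n.+1.

Lemma simple_rootE i k : alpha i k ord0 = (k == i)%:R.
Proof. by rewrite mxE eqxx andbT. Qed.

Lemma simple_root_inj : injective alpha.
Proof.
move=> i j /colP /(_ i); rewrite !simple_rootE eqxx.
by case: eqVneq.
Qed.

Lemma mulmx_simple_root (A : 'M[int]_n.+1) i : A *m alpha i = col i A.
Proof. by rewrite colE. Qed.

Lemma vec_simple_sum (v : vec) : v = \sum_i v i ord0 *: alpha i.
Proof.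
apply/colP => k; rewrite summxE (bigD1 k) //= big1 => [|i ik].
  by rewrite !mxE !eqxx mulr1 addr0.
by rewrite !mxE [k == i]eq_sym (negbTE ik) mulr0.
Qed.

Definition pairing i (v : vec) : int := (C *m v) i ord0.

Lemma pairingD i u v : pairing i (u + v) = pairing i u + pairing i v.
Proof. by rewrite /pairing mulmxDr mxE. Qed.
Lemma pairingZ i a v : pairing i (a *: v) = a * pairing i v.
Proof. by rewrite /pairing -scalemxAr mxE. Qed.
Lemma pairingN i v : pairing i (- v) = - pairing i v.
Proof. by rewrite /pairing mulmxN mxE. Qed.
Lemma pairing_simple i j : pairing i (alpha j) = C i j.
Proof. by rewrite /pairing mulmx_simple_root mxE. Qed.
Definition pairingE := (pairingD, pairingN, pairingZ, pairing_simple).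

Lemma reflE i v : refl C i *m v = v - pairing i v *: alpha i.
Proof.
rewrite /refl mulmxBl mul1mx -mulmxA; congr (_ - _); apply/colP => k.
rewrite mxE (bigD1 i) //= big1 => [|j ji].
  by rewrite /pairing !mxE !eqxx !andbT addr0 mulrC.
by rewrite mxE (negbTE ji) andbF mul0r.
Qed.

Lemma refl_simple i j : refl C i *m alpha j = alpha j - C i j *: alpha i.
Proof. by rewrite reflE pairing_simple. Qed.

Lemma refl_self i : refl C i *m alpha i = - alpha i.
Proof. by rewrite refl_simple C_diag; apply/colP => k; rewrite !mxE; ring. Qed.

Lemma eq_on_vec (A B : 'M[int]_n.+1) :
  (forall v : vec, A *m v = B *m v) -> A = B.
Proof.
move=> H; apply/matrixP => i j; have /colP/(_ i) := H (alpha j).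
by rewrite !mulmx_simple_root !mxE.
Qed.

Lemma refl_invol i : refl C i * refl C i = 1.
Proof.
apply: eq_on_vec => v; rewrite -mulmxE -mulmxA !reflE !pairingE C_diag mul1mx.
by apply/colP => k; rewrite !mxE; ring.
Qed.

Lemma refl_comm i j : C i j = 0 -> refl C i * refl C j = refl C j * refl C i.
Proof.
move=> Cij; apply: eq_on_vec => v; rewrite -mulmxE -!mulmxA !reflE !pairingE.
rewrite (C_sym j i) Cij; apply/colP => k; rewrite !mxE; ring.
Qed.

Lemma refl_braid i j : C i j = -1 ->
  refl C i * refl C j * refl C i = refl C j * refl C i * refl C j.
Proof.
move=> Cij; apply: eq_on_vec => v; rewrite -mulmxE -!mulmxA !reflE !pairingE.
rewrite (C_sym j i) Cij !C_diag; apply/colP => k; rewrite !mxE; ring.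
Qed.

(** Only row [i] differs from the identity, so that the cofactors of this row
    are those of the identity. *)
Lemma det_refl i : \det (refl C i) = -1.
Proof.
have offdiag (j : 'I_n.+1) k : j != i -> refl C i j k = (1%:M : 'M[int]_n.+1) j k.
  move=> ji; rewrite /refl mxE [X in _ + X]mxE [X in _ - X]mxE big1 ?oppr0 ?addr0 // => l _.
  by rewrite mxE (negbTE ji) mul0r.
have cof j : cofactor (refl C i) i j = cofactor (1%:M : 'M[int]_n.+1) i j.
  rewrite /cofactor; congr (_ * \det _); apply/matrixP => k l.
  by rewrite [LHS]mxE [LHS]mxE [RHS]mxE [RHS]mxE offdiag // eq_sym neq_lift.
have cof1 j : cofactor (1%:M : 'M[int]_n.+1) i j = (j == i)%:R.
  have : \adj (1%:M : 'M[int]_n.+1) = 1%:M.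
    by rewrite -[LHS]mulmx1 mul_adj_mx det1.
  by move/matrixP/(_ j i); rewrite mxE [RHS]mxE => ->.
rewrite (expand_det_row _ i) (bigD1 i) //= big1 => [|j ji].
  rewrite cof cof1 eqxx mulr1 addr0 !mxE eqxx (bigD1 i) //= big1 => [|l li].
    by rewrite !mxE !eqxx C_diag mul1r addr0.
  by rewrite mxE (negbTE li) andbF mul0r.
by rewrite cof cof1 (negbTE ji) mulr0.
Qed.

Local Notation word_mx := (word_mx C).

Lemma word_mx0 : word_mx [::] = 1. Proof. by rewrite /word_mx big_nil. Qed.
Lemma word_mx_cons i s : word_mx (i :: s) = refl C i * word_mx s.
Proof. by rewrite /word_mx big_cons. Qed.
Lemma word_mx_cat s t : word_mx (s ++ t) = word_mx s * word_mx t.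
Proof. by rewrite /word_mx big_cat. Qed.
Lemma word_mx_rcons s i : word_mx (rcons s i) = word_mx s * refl C i.
Proof. by rewrite -cats1 word_mx_cat word_mx_cons word_mx0 mulr1. Qed.

Lemma word_mx_rev s : word_mx s * word_mx (rev s) = 1.
Proof.
elim: s => [|i s IH]; first by rewrite word_mx0 mulr1.
rewrite rev_cons word_mx_cons word_mx_rcons mulrA -(mulrA _ _ (word_mx (rev s))) IH.
by rewrite mulr1 refl_invol.
Qed.

Lemma word_mx_revl s : word_mx (rev s) * word_mx s = 1.
Proof. by rewrite -{2}(revK s) word_mx_rev. Qed.

Lemma word_mx_inj s : injective (fun v : vec => word_mx s *m v).
Proof.
move=> u v /(congr1 (mulmx (word_mx (rev s)))).
by rewrite !mulmxA mulmxE word_mx_revl !mul1mx.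
Qed.

Lemma mulmx_cat s t (v : vec) : word_mx (s ++ t) *m v = word_mx s *m (word_mx t *m v).
Proof. by rewrite word_mx_cat mulmxA. Qed.
Lemma mulmx_rcons s i (v : vec) : word_mx (rcons s i) *m v = word_mx s *m (refl C i *m v).
Proof. by rewrite word_mx_rcons mulmxA. Qed.

Lemma det_word s : \det (word_mx s) = (-1) ^+ size s.
Proof.
elim: s => [|i s IH]; first by rewrite word_mx0 det1.
by rewrite word_mx_cons -mulmxE det_mulmx IH det_refl exprS.
Qed.

(** The determinant is the sign character of the Weyl group. *)
Lemma odd_size_word s t : word_mx s = word_mx t -> odd (size s) = odd (size t).
Proof.
move/(congr1 determinant); rewrite !det_word -signr_odd -[RHS]signr_odd.
by case: (odd _); case: (odd _).
Qed.

Definition reduced s := forall t, word_mx t = word_mx s -> (size s <= size t)%N.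

Lemma reduced_rcons_prefix s i : reduced (rcons s i) -> reduced s.
Proof.
move=> red t ts; have := red (rcons t i); rewrite !word_mx_rcons ts !size_rcons.
by move=> /(_ erefl).
Qed.

Lemma reduced_catl s t : reduced (s ++ t) -> reduced s.
Proof.
elim/last_ind: t => [|t i IH]; first by rewrite cats0.
by rewrite -rcons_cat => /reduced_rcons_prefix.
Qed.

Lemma reduced_catr s t : reduced (s ++ t) -> reduced t.
Proof.
move=> red u ut; have := red (s ++ u); rewrite !word_mx_cat ut !size_cat leq_add2l.
by move=> /(_ erefl).
Qed.

Lemma reduced_same s t :
  reduced s -> word_mx t = word_mx s -> (size t <= size s)%N -> reduced t.
Proof. by move=> red ts le u ut; apply: leq_trans le (red _ _); rewrite ut. Qed.

Lemma reduced_exists s : exists t, [/\ reduced t, word_mx t = word_mx s & (size t <= size s)%N].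
Proof.
have [m] := ubnP (size s); elim: m s => // m IH s; rewrite ltnS => lesm.
have [/existsP[k /existsP[t /eqP tw]]|none] :=
  boolP [exists k : 'I_(size s), [exists t : k.-tuple 'I_n.+1, word_mx t == word_mx s]].
  have [|u [redu uw leu]] := IH t; first by rewrite size_tuple (leq_trans (ltn_ord k)).
  exists u; split=> //; first by rewrite uw tw.
  by apply: leq_trans leu _; rewrite size_tuple ltnW.
exists s; split=> // t ts; rewrite leqNgt; apply/negP => lt.
case/negP: none; apply/existsP; exists (Ordinal lt); apply/existsP.
by exists (in_tuple t); rewrite /= ts.
Qed.

(** Multiplication by a reflection changes the length by one: it cannot preserve
    the length, by parity. *)
Lemma reduced_or_descent s i : reduced s ->
  reduced (rcons s i) \/ exists t, reduced (rcons t i) /\ word_mx (rcons t i) = word_mx s.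
Proof.
move=> red; have [t [redt tw le]] := reduced_exists (rcons s i).
have [eqs|ne] := eqVneq (size t) (size (rcons s i)).
  by left; apply: (reduced_same redt); rewrite ?tw ?eqs.
right; exists t; have tiw : word_mx (rcons t i) = word_mx s.
  by rewrite word_mx_rcons tw word_mx_rcons -mulrA refl_invol mulr1.
split=> //; apply: (reduced_same red tiw); rewrite size_rcons.
have ne' : size t != size s.
  apply/eqP => E; have := odd_size_word tw; rewrite size_rcons E /=.
  by case: (odd _).
by rewrite size_rcons in le ne; lia.
Qed.

Definition nonneg (v : vec) := forall k, 0 <= v k ord0.

Lemma nonneg_simple i : nonneg (alpha i).
Proof. by move=> k; rewrite simple_rootE ler0n. Qed.

Lemma nonnegD u v : nonneg u -> nonneg v -> nonneg (u + v).
Proof. by move=> hu hv k; rewrite mxE addr_ge0. Qed.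

Lemma nonnegZ a v : 0 <= a -> nonneg v -> nonneg (a *: v).
Proof. by move=> ha hv k; rewrite mxE mulr_ge0. Qed.

Lemma nonneg_anti v : nonneg v -> nonneg (- v) -> v = 0.
Proof.
move=> h1 h2; apply/colP => k; apply/eqP; rewrite eq_le mxE h1 andbT.
by have := h2 k; rewrite mxE oppr_ge0.
Qed.

Lemma simple_root_neq0 i : alpha i != 0.
Proof. by apply/eqP => /colP/(_ i); rewrite simple_rootE eqxx mxE. Qed.

Lemma root_neq0 s i : word_mx s *m alpha i != 0.
Proof.
apply/eqP => h; have := simple_root_neq0 i; rewrite -(inj_eq (@word_mx_inj s)).
by rewrite h mulmx0 eqxx.
Qed.

(** Induction on the length, on the last letter [j] of the word.  If [i] and [j]
    are orthogonal, then [j] may be dropped.  Otherwise [j] turns [alpha_i] into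
    [alpha_i + alpha_j], and the induction hypothesis applies to both terms,
    unless the shorter word [s] can be made to end with [i], say [s = t i]; then
    [s] sends [alpha_i + alpha_j] to the image of [alpha_j] under [t], and [t j]
    is reduced as a prefix of the reduced word [t j i j] of the element of
    [t i j i]. *)
Theorem reduced_root_nonneg s i : reduced (rcons s i) -> nonneg (word_mx s *m alpha i).
Proof.
have [m] := ubnP (size s); elim: m s i => // m IH s i; rewrite ltnS => lesm.
case/lastP: s lesm => [|s j]; first by move=> *; rewrite word_mx0 mul1mx; apply: nonneg_simple.
rewrite size_rcons => lesm red; rewrite mulmx_rcons.
have [eij|nij] := eqVneq i j.
  subst j; have := red s; rewrite !word_mx_rcons -mulrA refl_invol mulr1 => /(_ erefl).
  by rewrite !size_rcons ltnNge leqnSn.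
have redsj := reduced_rcons_prefix red.
have reds := reduced_rcons_prefix redsj.
rewrite refl_simple C_sym; case: (C_off nij) => Cij; rewrite Cij.
  rewrite scale0r subr0; apply: IH => //; apply: (@reduced_catl _ [:: j]).
  rewrite cats1; apply: (reduced_same red); last by rewrite !size_rcons.
  by rewrite !word_mx_rcons -!mulrA (refl_comm Cij).
rewrite scaleN1r opprK mulmxDr.
case: (reduced_or_descent i reds) => [redsi|[t [redti tw]]].
  by apply: nonnegD; apply: IH.
have redt := reduced_rcons_prefix redti.
have szt : size s = (size t).+1.
  by rewrite -(size_rcons t i); apply/eqP; rewrite eqn_leq reds //= redti.
have redtj : reduced (rcons t j).
  apply: (@reduced_catl _ [:: i; j]); apply: (reduced_same red).
    rewrite -cats1 -catA /= word_mx_cat !word_mx_rcons -tw word_mx_rcons.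
    rewrite !word_mx_cons word_mx0 mulr1 -!mulrA; congr (_ * _).
    by rewrite !mulrA refl_braid // C_sym.
  by rewrite size_cat !size_rcons szt /=; lia.
rewrite -mulmxDr -tw mulmx_rcons mulmxDr refl_self refl_simple Cij scaleN1r opprK.
rewrite addrC addrK; apply: IH => //; lia.
Qed.

Lemma root_sign s i : nonneg (word_mx s *m alpha i) \/ nonneg (- (word_mx s *m alpha i)).
Proof.
have [t [redt <- _]] := reduced_exists s.
case: (reduced_or_descent i redt) => [red|[u [redu uw]]].
  by left; apply: reduced_root_nonneg.
right; rewrite -uw mulmx_rcons refl_self mulmxN opprK.
exact: reduced_root_nonneg.
Qed.

Lemma weyl_length_le (w : weyl C) s : weyl_mx w = word_mx s -> (weyl_length w <= size s)%N.
Proof.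
move=> ws; rewrite /weyl_length; case: ex_minnP => m _; apply.
by apply/existsP; exists (in_tuple s); rewrite ws.
Qed.

Lemma weyl_reduced_word (w : weyl C) :
  exists s, [/\ reduced s, word_mx s = weyl_mx w & size s = weyl_length w].
Proof.
have [s [ws szs]] : exists s, weyl_mx w = word_mx s /\ size s = weyl_length w.
  rewrite /weyl_length; case: ex_minnP => m /existsP[s /eqP ws] _.
  by exists s; rewrite size_tuple.
exists s; split=> // t ts; rewrite szs; apply: weyl_length_le; congruence.
Qed.

Lemma reduced_weyl_length (w : weyl C) s :
  reduced s -> weyl_mx w = word_mx s -> weyl_length w = size s.
Proof.
move=> red ws; apply/eqP; rewrite eqn_leq weyl_length_le //=.
by have [t [_ tw <-]] := weyl_reduced_word w; apply: red; congruence.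
Qed.

Lemma length_up_nonneg (w : weyl C) i :
  (weyl_length w < weyl_length (weyl_mulr w i))%N -> nonneg (w *m alpha i).
Proof.
have [s [red sw sz]] := weyl_reduced_word w; rewrite -sw.
case: (reduced_or_descent i red) => [red' _|[t [redt tw]]]; first exact: reduced_root_nonneg.
have : weyl_mx (weyl_mulr w i) = word_mx t.
  by rewrite /= -sw -tw word_mx_rcons -mulrA refl_invol mulr1.
move/weyl_length_le => le1; have := redt s (esym tw); rewrite size_rcons -sz; lia.
Qed.

Lemma length_down_nonpos (w : weyl C) i :
  ~~ (weyl_length w < weyl_length (weyl_mulr w i))%N -> nonneg (- (w *m alpha i)).
Proof.
have [s [red sw sz]] := weyl_reduced_word w; rewrite -sw.
case: (reduced_or_descent i red) => [red'|[t [redt tw]] _].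
  rewrite (@reduced_weyl_length (weyl_mulr w i) (rcons s i)) ?size_rcons -?sz ?ltnSn //.
  by rewrite word_mx_rcons sw.
rewrite -tw mulmx_rcons refl_self mulmxN opprK.
exact: reduced_root_nonneg.
Qed.

Definition antidominant (A : 'M[int]_n.+1) := forall i, nonneg (- (A *m alpha i)).

Lemma antidominant_nonpos A v : antidominant A -> nonneg v -> nonneg (- (A *m v)).
Proof.
move=> anti v0; rewrite (vec_simple_sum v) mulmx_sumr -sumrN.
elim/big_ind: _ => [k|u u'|i _]; first by rewrite mxE.
  exact: nonnegD.
by rewrite -scalemxAr -scalerN; apply: nonnegZ.
Qed.

Lemma longest_antidominant (w0 : weyl C) : longest w0 -> antidominant w0.
Proof. by move=> lg i; apply: length_down_nonpos; rewrite -leqNgt. Qed.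

Lemma antidominant_rev s : antidominant (word_mx s) -> antidominant (word_mx (rev s)).
Proof.
move=> anti i; case: (root_sign (rev s) i) => // /(antidominant_nonpos anti).
rewrite mulmxA mulmxE word_mx_rev mul1mx => neg.
have := simple_root_neq0 i; rewrite (nonneg_anti (@nonneg_simple i) neg).
by rewrite eqxx.
Qed.

(** Minus the element and minus its inverse are mutually inverse matrices with
    nonnegative integral entries, hence permutation matrices. *)
Lemma antidominant_simple s i : antidominant (word_mx s) ->
  exists j, word_mx s *m alpha i = - alpha j.
Proof.
move=> anti; have anti' := antidominant_rev anti.
set N := word_mx (rev s) in anti'.
pose v := - (word_mx s *m alpha i).
have v0 : nonneg v by apply: anti.
have [j vj] : exists j, 0 < v j ord0.
  case: (pickP (fun j => 0 < v j ord0)) => [j vj|none]; first by exists j.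
  have := root_neq0 s i; rewrite -oppr_eq0 -/v; case/eqP; apply/colP => k.
  by rewrite [RHS]mxE; apply/eqP; rewrite eq_le v0 andbT leNgt; apply/negbT/none.
have sumv : alpha i = \sum_k v k ord0 *: - (N *m alpha k).
  have -> : alpha i = N *m (word_mx s *m alpha i).
    by rewrite mulmxA mulmxE word_mx_revl mul1mx.
  rewrite -(opprK (word_mx s *m _)) mulmxN -/v {1}(vec_simple_sum v).
  by rewrite mulmx_sumr -sumrN; apply: eq_bigr => k _; rewrite -scalemxAr scalerN.
(* The nonnegative summands of alpha_i are multiples of alpha_i. *)
have coef l : v j ord0 * (- (N *m alpha j)) l ord0 <= (l == i)%:R.
  rewrite -simple_rootE sumv summxE (bigD1 j) //= [X in _ <= X + _]mxE lerDl sumr_ge0 // => k _.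
  by rewrite mxE mulr_ge0 //; apply: anti'.
exists j; suff Nj : N *m alpha j = - alpha i.
  apply: oppr_inj; rewrite opprK -mulmxN -Nj mulmxA mulmxE word_mx_rev.
  by rewrite mul1mx.
apply: oppr_inj; rewrite opprK; move: coef (anti' j).
move: (root_neq0 (rev s) j); rewrite -oppr_eq0 -/N.
move: (- (N *m alpha j)) => u u0 coef upos.
have ul l : l != i -> u l ord0 = 0.
  move=> li; apply/eqP; rewrite eq_le upos andbT.
  by have := coef l; rewrite (negbTE li) pmulr_rle0.
have ui : u i ord0 != 0.
  apply: contra u0 => /eqP ui; apply/eqP/colP => l; rewrite mxE.
  by have [->|/ul] := eqVneq l i.
apply/colP => l; rewrite simple_rootE; have [->|/ul //] := eqVneq l i.
have := coef i; have := upos i; rewrite eqxx /=; move: ui vj.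
by move: (u i ord0) (v j ord0) => a c; nia.
Qed.

(** A nontrivial element has a reduced word, and sends the simple root of its
    last letter to a nonpositive vector. *)
Lemma dominant_id s : (forall i, nonneg (word_mx s *m alpha i)) -> word_mx s = 1.
Proof.
have [t [red <- _]] := reduced_exists s; case/lastP: t red => [|t i] red dom.
  by rewrite word_mx0.
have := dom i; rewrite mulmx_rcons refl_self mulmxN => neg.
have := root_neq0 t i; rewrite (nonneg_anti (reduced_root_nonneg red) neg).
by rewrite eqxx.
Qed.

Lemma antidominant_unique s t :
  antidominant (word_mx s) -> antidominant (word_mx t) -> word_mx s = word_mx t.
Proof.
move=> antis antit; have : word_mx (s ++ rev t) = 1.
  apply: dominant_id => i; rewrite mulmx_cat.
  have [j ->] := antidominant_simple i (antidominant_rev antit).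
  by rewrite mulmxN; apply: antis.
rewrite word_mx_cat => /(congr1 (fun A => A * word_mx t)).
by rewrite -mulrA word_mx_revl mulr1 mul1r.
Qed.

Lemma simple_root_star (w0 : weyl C) i : longest w0 ->
  alpha (star w0 i) = - (w0 *m alpha i).
Proof.
move=> /longest_antidominant; have [s ws] := weyl_word w0; rewrite /star ws => anti.
case: pickP => [j /eqP //|none].
have [j Dj] := antidominant_simple i anti.
by have := none j; rewrite Dj opprK eqxx.
Qed.

(** The invariant form; it recovers the Cartan matrix from the roots of the
    strands. *)
Definition cartan_form (u v : vec) : int := (u^T *m C *m v) ord0 ord0.

Lemma cartan_form_simplel i v : cartan_form (alpha i) v = pairing i v.
Proof.
rewrite /cartan_form -mulmxA mxE (bigD1 i) //= big1 => [|j ji].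
  by rewrite /pairing !mxE !eqxx mul1r addr0.
by rewrite !mxE (negbTE ji) mul0r.
Qed.

Lemma cartan_form_sym u v : cartan_form u v = cartan_form v u.
Proof.
have CT : C^T = C by apply/matrixP => i j; rewrite mxE.
have -> : cartan_form u v = (u^T *m C *m v)^T ord0 ord0 by rewrite mxE.
by rewrite !trmx_mul trmxK CT mulmxA.
Qed.

Lemma cartan_formDl u u' v : cartan_form (u + u') v = cartan_form u v + cartan_form u' v.
Proof. by rewrite /cartan_form linearD /= !mulmxDl mxE. Qed.
Lemma cartan_formZl a u v : cartan_form (a *: u) v = a * cartan_form u v.
Proof. by rewrite /cartan_form linearZ /= -!scalemxAl mxE. Qed.
Lemma cartan_formNl u v : cartan_form (- u) v = - cartan_form u v.
Proof. by rewrite -scaleN1r cartan_formZl mulN1r. Qed.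

Lemma cartan_form_refl i u v : cartan_form (refl C i *m u) (refl C i *m v) = cartan_form u v.
Proof.
rewrite !reflE !(cartan_formDl, cartan_formNl, cartan_formZl) cartan_form_simplel.
rewrite !(cartan_form_sym u, pairingE) C_diag.
rewrite !(cartan_formDl, cartan_formNl, cartan_formZl) cartan_form_simplel.
rewrite (cartan_form_sym v u); ring.
Qed.

Lemma cartan_form_word s u v : cartan_form (word_mx s *m u) (word_mx s *m v) = cartan_form u v.
Proof.
elim: s => [|i s IH]; first by rewrite word_mx0 !mul1mx.
by rewrite word_mx_cons -mulmxE -!mulmxA cartan_form_refl.
Qed.

Lemma cartan_form_roots s i j : cartan_form (word_mx s *m alpha i) (word_mx s *m alpha j) = C i j.
Proof. by rewrite cartan_form_word cartan_form_simplel pairing_simple. Qed.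

Lemma cartan_star (w0 : weyl C) i j : longest w0 -> C (star w0 i) (star w0 j) = C i j.
Proof.
move=> lg; rewrite -pairing_simple -cartan_form_simplel !simple_root_star //.
have [s ->] := weyl_word w0.
by rewrite cartan_formNl cartan_form_sym cartan_formNl opprK cartan_form_roots.
Qed.

Lemma star_inj (w0 : weyl C) : longest w0 -> injective (star w0).
Proof.
move=> lg i j /(congr1 alpha); rewrite !simple_root_star // => /oppr_inj.
have [s ->] := weyl_word w0.
by move=> /word_mx_inj /simple_root_inj.
Qed.

Definition demazure_step (w : weyl C) i : weyl C :=
  if (weyl_length w < weyl_length (weyl_mulr w i))%N then weyl_mulr w i else w.

Lemma demazure_cat s t : demazure C (s ++ t) = foldl demazure_step (demazure C s) t.
Proof. by rewrite /demazure foldl_cat. Qed.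

Lemma demazure_rcons s i : demazure C (rcons s i) = demazure_step (demazure C s) i.
Proof. by rewrite -cats1 demazure_cat. Qed.

Lemma demazure_reduced s : reduced s -> weyl_mx (demazure C s) = word_mx s.
Proof.
elim/last_ind: s => [|s i IH] red; first by rewrite word_mx0.
have reds := reduced_rcons_prefix red.
rewrite demazure_rcons /demazure_step (reduced_weyl_length reds) ?IH //.
rewrite (@reduced_weyl_length (weyl_mulr _ i) (rcons s i)) ?size_rcons ?ltnSn //=.
  by rewrite IH // word_mx_rcons.
by rewrite word_mx_rcons IH.
Qed.

(** Every inversion of [A], that is, every positive root that [A] makes negative,
    is an inversion of [B].  It replaces the comparison of [A] and [B] in the weak
    order. *)
Definition inversions_sub (A B : 'M[int]_n.+1) :=
  forall u j, let b := word_mx u *m alpha j in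
    nonneg b -> nonneg (- (A *m b)) -> nonneg (- (B *m b)).

(** The root [s_i b] is an inversion of [v], hence of [w].  If the length of [w]
    increases, this is what is needed.  If not, [w alpha_i] is nonpositive, and
    [b] differs from [s_i b] by a multiple of [alpha_i]: a nonnegative multiple
    does no harm, and with a negative one [b] itself is an inversion of [v].  When
    [s_i b] is not positive, [b] is a multiple of [alpha_i]. *)
Lemma inversions_sub_step v (w : weyl C) i :
  inversions_sub (word_mx v) w -> nonneg (word_mx v *m alpha i) ->
  inversions_sub (word_mx (rcons v i)) (demazure_step w i).
Proof.
move=> sub vi u j b; have Db : b = word_mx u *m alpha j by [].
have subb := sub u j; rewrite /= -Db in subb.
clearbody b => b0; rewrite mulmx_rcons => vb.
have db' : refl C i *m b = word_mx (i :: u) *m alpha j by rewrite Db word_mx_cons -mulmxE mulmxA.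
have := root_sign (i :: u) j; rewrite -db'.
have bE : b = refl C i *m b + pairing i b *: alpha i by rewrite reflE subrK.
have wi : if (weyl_length w < weyl_length (weyl_mulr w i))%N
          then nonneg (w *m alpha i) else nonneg (- (w *m alpha i)).
  by case: ifPn => [/length_up_nonneg|/length_down_nonpos].
case=> [b'0|b'0].
  have wb' : nonneg (- (w *m (refl C i *m b))).
    by rewrite db'; apply: sub; rewrite -db'.
  rewrite /demazure_step; case: ifP wi => [_ _|_ wi].
    by rewrite /= -mulmxE -mulmxA.
  have [m0|m0] := leP 0 (pairing i b).
    rewrite {1}bE.
    by rewrite mulmxDr -scalemxAr opprD -scalerN; apply: nonnegD => //; apply: nonnegZ.
  apply: subb => //; rewrite {1}bE.
  rewrite mulmxDr -scalemxAr opprD -scaleNr; apply: nonnegD => //.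
  by apply: nonnegZ => //; rewrite oppr_ge0 ltW.
have bi : b = b i ord0 *: alpha i.
  apply/colP => k; rewrite mxE simple_rootE; have [->|ki] := eqVneq k i; first by rewrite mulr1.
  rewrite mulr0; apply/eqP; rewrite eq_le b0 andbT.
  have := b'0 k; rewrite reflE opprB !mxE (negbTE ki).
  by rewrite mulr0 add0r oppr_ge0.
rewrite /demazure_step bi; case: ifP wi => _ wi /=.
  rewrite -scalemxAr -mulmxE -mulmxA refl_self mulmxN scalerN opprK.
  exact: nonnegZ.
by rewrite -scalemxAr -scalerN; apply: nonnegZ.
Qed.

Lemma inversions_sub_demazure (w : weyl C) v : reduced v ->
  inversions_sub (word_mx v) (foldl demazure_step w v).
Proof.
elim/last_ind: v => [_|v i IH red].
  move=> u j b b0; rewrite word_mx0 mul1mx => /(nonneg_anti b0).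
  by rewrite /b => /eqP; rewrite (negbTE (root_neq0 u j)).
rewrite foldl_rcons; apply: inversions_sub_step.
  exact/IH/(reduced_rcons_prefix red).
exact: reduced_root_nonneg.
Qed.

Lemma demazure_step_antidominant (w : weyl C) i :
  antidominant w -> demazure_step w i = w.
Proof.
move=> anti; rewrite /demazure_step; case: ifP => // /length_up_nonneg pos.
have := nonneg_anti pos (anti i); have [s ->] := weyl_word w.
by move/eqP; rewrite (negbTE (root_neq0 s i)).
Qed.

(** After the letters of [D] all the inversions of the longest element are
    inversions of the Demazure product, whatever preceded [D]. *)
Lemma demazure_longest (w0 : weyl C) s D t :
  longest w0 -> reduced D -> word_mx D = w0 ->
  weyl_mx (demazure C (s ++ D ++ t)) = w0.
Proof.
move=> lg red Dw; rewrite catA demazure_cat.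
have anti : antidominant (demazure C (s ++ D)).
  rewrite demazure_cat => i; have := inversions_sub_demazure (demazure C s) red.
  move=> /(_ [::] i) /=; rewrite word_mx0 mul1mx Dw; apply.
    exact: nonneg_simple.
  exact: longest_antidominant.
have -> : foldl demazure_step (demazure C (s ++ D)) t = demazure C (s ++ D).
  by elim: t => //= i t; rewrite demazure_step_antidominant.
move: anti; have [u ->] := weyl_word (demazure C (s ++ D)).
move: (longest_antidominant lg); rewrite -Dw => antiD antiu.
exact: antidominant_unique.
Qed.

End Coxeter.

(** * Roots and cycles under 4- and 6-valent vertices *)

Arguments det3 : simpl never.

Lemma det3E (a b c a' b' c' : nat) :
  det3 (a, b, c) (a', b', c') =
  (b%:R * c'%:R - c%:R * b'%:R) - (a%:R * c'%:R - c%:R * a'%:R)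
  + (a%:R * b'%:R - b%:R * a'%:R).
Proof.
rewrite /det3 (expand_det_row _ ord0) !big_ord_recl big_ord0 /cofactor.
rewrite !(expand_det_row _ ord0) !big_ord_recl !big_ord0 /cofactor !det_mx11 !mxE /=.
by rewrite !(expr0, expr1, addn0, add0n) /=; ring.
Qed.

Section RootMoves.

Context (n : nat) (C : 'M[int]_n.+1).
Context (C_diag : forall i, C i i = 2).
Context (C_sym : forall i j, C i j = C j i).
Context (C_off : forall i j, i != j -> C i j = 0 \/ C i j = -1).

Notation alpha := (@simple_root n).
Notation vec := 'cV[int]_n.+1.
Notation word_mx := (word_mx C).
Notation reduced := (reduced C).

Fixpoint strand_roots (A : 'M[int]_n.+1) (s : seq 'I_n.+1) : seq vec :=
  if s is i :: s' then A *m alpha i :: strand_roots (A * refl C i) s' else [::].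

(** The roots of the strands of a slice, that is, the inversions of the inverse
    of the element, in the convex order given by the word. *)
Definition root_seq := strand_roots 1.

Lemma size_strand_roots A s : size (strand_roots A s) = size s.
Proof. by elim: s A => //= i s IH A; rewrite IH. Qed.

Lemma strand_roots_cat A s t :
  strand_roots A (s ++ t) = strand_roots A s ++ strand_roots (A * word_mx s) t.
Proof.
elim: s A => [|i s IH] A /=; first by rewrite word_mx0 mulr1.
by rewrite IH word_mx_cons mulrA.
Qed.

Lemma root_seq_cat s t : root_seq (s ++ t) = root_seq s ++ strand_roots (word_mx s) t.
Proof. by rewrite /root_seq strand_roots_cat mul1r. Qed.

Lemma root_seq_rcons s i : root_seq (rcons s i) = rcons (root_seq s) (word_mx s *m alpha i).
Proof. by rewrite -!cats1 root_seq_cat. Qed.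

Lemma size_root_seq s : size (root_seq s) = size s.
Proof. exact: size_strand_roots. Qed.

Lemma mem_root_seq s v : v \in root_seq s ->
  exists u i t, s = u ++ i :: t /\ v = word_mx u *m alpha i.
Proof.
elim/last_ind: s => // s i IH; rewrite root_seq_rcons mem_rcons inE => /orP[/eqP->|/IH].
  by exists s, i, [::]; rewrite cats1.
by move=> [u [j [t [-> ->]]]]; exists u, j, (rcons t i); rewrite rcons_cat.
Qed.

Lemma root_seq_nonneg s v : reduced s -> v \in root_seq s -> nonneg v.
Proof.
move=> red /mem_root_seq[u [i [t [Ds ->]]]]; apply: reduced_root_nonneg => //.
by apply: (@reduced_catl _ _ _ t); rewrite cat_rcons -Ds.
Qed.

(** If two strands carry the same root, then the word between them sends the
    simple root of its last letter to the negative of a simple root. *)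
Lemma root_seq_uniq s : reduced s -> uniq (root_seq s).
Proof.
elim/last_ind: s => // s i IH red; rewrite root_seq_rcons rcons_uniq.
apply/andP; split; last exact/IH/(reduced_rcons_prefix red).
apply/negP => /mem_root_seq[u [j [t [Ds]]]]; rewrite Ds mulmx_cat => /word_mx_inj H.
have {H} : word_mx (j :: t) *m alpha i = alpha j by apply: H.
rewrite word_mx_cons -mulmxE -mulmxA => /(congr1 (mulmx (refl C j))).
rewrite mulmxA mulmxE refl_invol // mul1mx refl_self // => neg.
have redt : reduced (rcons t i).
  by apply: (@reduced_catr _ _ (rcons u j)); rewrite cat_rcons -rcons_cons -rcons_cat -Ds.
have := reduced_root_nonneg C_diag C_sym C_off redt; rewrite neg => neg'.
have := simple_root_neq0 j; rewrite (nonneg_anti (@nonneg_simple _ j) neg').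
by rewrite eqxx.
Qed.

Inductive root_move : vertex -> seq vec -> seq vec -> Prop :=
| RootMove4 l b c m : cartan_form C b c = 0 ->
    root_move (Fourvalent (size l)) (l ++ [:: b; c] ++ m) (l ++ [:: c; b] ++ m)
| RootMove6 l b c m : cartan_form C b c = -1 ->
    root_move (Sixvalent (size l)) (l ++ [:: b; b + c; c] ++ m) (l ++ [:: c; b + c; b] ++ m).

Lemma move_roots v s s' : ~~ is_trivalent v -> apply_vertex C v s = Some s' ->
  [/\ word_mx s' = word_mx s, size s' = size s & root_move v (root_seq s) (root_seq s')].
Proof.
have split_at p i u : drop p s = i :: u ->
    exists2 l, p = size l & s = l ++ i :: u /\ take p s = l.
  move=> E; have lt : (p < size s)%N.
    by rewrite ltnNge; apply/negP => /drop_oversize; rewrite E.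
  by exists (take p s); [rewrite size_takel // ltnW | rewrite -E cat_take_drop].
case: v => //= p _; case E: drop => [|i [|j u]] //.
  case: ifP => // /andP[ij /eqP Cij] [<-].
  have [l -> [-> ->]] := split_at _ _ _ E; split; last 1 first.
  - rewrite -[[:: i, j & u]]/([:: i; j] ++ u) -[[:: j, i & u]]/([:: j; i] ++ u).
    rewrite !(root_seq_cat l) !strand_roots_cat /= -!mulmxE -!mulmxA.
    rewrite !refl_simple (C_sym j i) Cij !scale0r !subr0.
    rewrite !mulmxE !word_mx_cons !word_mx0 !mulr1 (refl_comm C_sym Cij).
    by rewrite -(size_root_seq l); apply: RootMove4; rewrite cartan_form_roots.
  - by rewrite !word_mx_cat !word_mx_cons !(mulrA (refl C _)) (refl_comm C_sym Cij).
  - by rewrite !size_cat.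
case: u E => // k u E; case: ifP => // /andP[/eqP ki /eqP Cij] [<-]; subst k.
have br := refl_braid C_diag C_sym Cij.
have [l -> [-> ->]] := split_at _ _ _ E; split; last 1 first.
- rewrite -[[:: i, j, i & u]]/([:: i; j; i] ++ u) -[[:: j, i, j & u]]/([:: j; i; j] ++ u).
  rewrite !(root_seq_cat l) !strand_roots_cat /= -!mulmxE -!mulmxA.
  have Eij : refl C i *m simple_root j = simple_root j + simple_root i.
    by rewrite refl_simple Cij scaleN1r opprK.
  have Eji : refl C j *m simple_root i = simple_root i + simple_root j.
    by rewrite refl_simple C_sym Cij scaleN1r opprK.
  rewrite Eij Eji !(mulmxDr (refl C _)) Eij Eji !refl_self // !(addrC (- _)) !addrK !mulmxDr.
  rewrite !mulmxE !word_mx_cons !word_mx0 !mulr1 !(mulrA (refl C _)) br.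
  rewrite -(size_root_seq l) (addrC (word_mx l *m simple_root j)).
  by apply: RootMove6; rewrite cartan_form_roots.
- by rewrite !word_mx_cat !word_mx_cons !mulrA -!(mulrA (word_mx l)) br.
by rewrite !size_cat.
Qed.

Definition marks (a : vec) (l : seq vec) : seq nat := [seq (v == a : nat) | v <- l].

Lemma size_marks a l : size (marks a l) = size l.
Proof. exact: size_map. Qed.

(** A filtered list is used, rather than two indices, because a vertex changes
    only a short factor of the list. *)
Definition comes_first (a b : vec) (l : seq vec) : bool :=
  ohead [seq v <- l | (v == a) || (v == b)] == Some a.

Lemma comes_first_cat a b l m : comes_first a b (l ++ m) =
  if has (fun v => (v == a) || (v == b)) l then comes_first a b l else comes_first a b m.
Proof.
rewrite /comes_first filter_cat has_filter.
by case: [seq v <- l | _] => [|x s] //=.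
Qed.

Lemma sum_not_simple b c i : nonneg b -> nonneg c -> b != 0 -> c != 0 -> (b + c == alpha i) = false.
Proof.
move=> b0 c0 bn cn; apply/negP => /eqP bc.
have coef k : b k ord0 + c k ord0 = (k == i)%:R by rewrite -simple_rootE -bc mxE.
have zero_off k : k != i -> b k ord0 = 0 /\ c k ord0 = 0.
  by move=> ki; have := coef k; have := b0 k; have := c0 k; rewrite (negbTE ki) /=; lia.
have : b i ord0 = 0 \/ c i ord0 = 0.
  by have := coef i; have := b0 i; have := c0 i; rewrite eqxx /=; lia.
case=> z; [case/eqP: bn | case/eqP: cn]; apply/colP => k; rewrite mxE;
  by have [->|/zero_off[]] := eqVneq k i.
Qed.

End RootMoves.

Arguments propagate : simpl never.
Arguments local_intersection : simpl never.

Lemma nth_catE (T : Type) (x0 : T) p (l m : seq T) : size l = p ->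
  ((nth x0 (l ++ m) p = nth x0 m 0) * (nth x0 (l ++ m) p.+1 = nth x0 m 1)
   * (nth x0 (l ++ m) p.+2 = nth x0 m 2))%type.
Proof.
have at_ k : nth x0 (l ++ m) (size l + k) = nth x0 m k.
  by rewrite nth_cat ltnNge leq_addr addKn.
by move=> <-; rewrite -(at_ 0%N) -(at_ 1%N) -(at_ 2%N) addn0 addn1 addn2.
Qed.

Lemma drop_catE (T : Type) p (l m : seq T) : size l = p ->
  ((drop p.+2 (l ++ m) = drop 2 m) * (drop p.+3 (l ++ m) = drop 3 m))%type.
Proof.
have at_ k : drop (size l + k) (l ++ m) = drop k m.
  by rewrite drop_cat ltnNge leq_addr addKn.
by move=> <-; rewrite -(at_ 2%N) -(at_ 3%N) addn2 addn3.
Qed.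

Lemma propagate4 p g x y h : size g = p ->
  propagate (Fourvalent p) (g ++ x :: y :: h) = g ++ y :: x :: h.
Proof.
by move=> gp; rewrite /propagate !(nth_catE _ _ gp) (drop_catE _ gp) take_size_cat //= drop0.
Qed.

Lemma propagate6 p g x y z h : size g = p ->
  propagate (Sixvalent p) (g ++ x :: y :: z :: h) =
  g ++ (y + z - minn x z)%N :: minn x z :: (x + y - minn x z)%N :: h.
Proof.
by move=> gp; rewrite /propagate !(nth_catE _ _ gp) (drop_catE _ gp) take_size_cat //= drop0.
Qed.

Lemma local_intersection6 p g1 g1' g2 g2' x1 y1 z1 h1 x1' y1' z1' h1' x2 y2 z2 h2 x2' y2' z2' h2' :
  size g1 = p -> size g1' = p -> size g2 = p -> size g2' = p ->
  local_intersection (Sixvalent p)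
    (g1 ++ x1 :: y1 :: z1 :: h1) (g1' ++ x1' :: y1' :: z1' :: h1')
    (g2 ++ x2 :: y2 :: z2 :: h2) (g2' ++ x2' :: y2' :: z2' :: h2') =
  2^-1 * (det3 (x1, y1', z1) (x2, y2', z2) + det3 (x1', z1', y1) (x2', z2', y2)).
Proof.
move=> s1 s1' s2 s2'; rewrite /local_intersection.
by rewrite !(nth_catE _ _ s1) !(nth_catE _ _ s1') !(nth_catE _ _ s2) !(nth_catE _ _ s2').
Qed.

Section RootMoveCycles.

Context (n : nat) (C : 'M[int]_n.+1).
Context (C_diag : forall i, C i i = 2).
Context (C_sym : forall i j, C i j = C j i).
Context (C_off : forall i j, i != j -> C i j = 0 \/ C i j = -1).

Notation alpha := (@simple_root n).
Notation vec := 'cV[int]_n.+1.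

Lemma root_move_perm v (l l' : seq vec) : root_move C v l l' -> perm_eq l l'.
Proof.
case=> {}l b c m _; rewrite perm_cat2l perm_cat2r; apply/seq.permP => P /=; lia.
Qed.

(** On the triple [b, b + c, c] an indicator of a simple root takes the values
    [(1, 0, 0)], [(0, 0, 1)] or 0, and on such values the propagation rule is the
    reversal of the triple. *)
Lemma root_move_marks v (l l' : seq vec) i : root_move C v l l' ->
  uniq l -> (forall b, b \in l -> nonneg b /\ b != 0) ->
  propagate v (marks (alpha i) l) = marks (alpha i) l'.
Proof.
case=> {}l b c m bc; rewrite /marks !map_cat /= => ul pos.
  by rewrite propagate4 // size_map.
rewrite propagate6 ?size_map //.
have [b0 bn] : nonneg b /\ b != 0 by apply: pos; rewrite !mem_cat !inE eqxx orbT.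
have [c0 cn] : nonneg c /\ c != 0 by apply: pos; rewrite !mem_cat !inE eqxx !orbT.
rewrite sum_not_simple //.
have bc' : b != c.
  move: ul; rewrite !cat_uniq /= !inE !negb_or.
  by case/and3P=> _ _ /andP[/and3P[]].
have [Eb|_] := eqVneq b (alpha i); last by rewrite min0n ?subn0 ?addn0.
by have [Ec|_] := eqVneq c (alpha i); first by rewrite Eb Ec eqxx in bc'.
Qed.

(** The two determinants of a 6-valent vertex are equal; each is -1 if [a] goes
    from left to right and +1 if it goes from right to left, and they vanish if
    one of the two roots is missing.  A 4-valent vertex cannot exchange [a] and
    [b] when their form is -1, because it exchanges orthogonal roots. *)
Lemma root_move_intersection v (l l' : seq vec) i j : root_move C v l l' ->
  uniq l -> (forall b, b \in l -> nonneg b /\ b != 0) -> i != j ->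
  let a := alpha i in let b := alpha j in
  local_intersection v (marks a l) (marks a l') (marks b l) (marks b l') =
  if C i j == -1 then (comes_first a b l')%:R - (comes_first a b l)%:R else 0.
Proof.
move=> mv ul pos ij.
have aij : (alpha i == alpha j) = false by rewrite (inj_eq (@simple_root_inj n)); apply/negbTE.
have aji : (alpha j == alpha i) = false by rewrite eq_sym.
pose test := fun v => (v == alpha i) || (v == alpha j).
have both b c : b != c -> test b && test c ->
    b = alpha i /\ c = alpha j \/ b = alpha j /\ c = alpha i.
  by move=> bc /andP[/orP[]/eqP Eb /orP[]/eqP Ec]; move: bc; rewrite Eb Ec ?eqxx; auto.
case: mv ul pos => {}l b c m bc ul pos /=.
  case: eqP => // Cij; rewrite !comes_first_cat /comes_first /= -/(test b) -/(test c).
  have nbc : b != c.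
    by move: ul; rewrite !cat_uniq /= !inE !negb_or; case/and3P=> _ _ /andP[/andP[]].
  have := both b c nbc; case Tb : (test b); case Tc : (test c) => //= H; rewrite ?subrr //.
  move: bc; case: H => // -[-> ->]; rewrite cartan_form_simplel pairing_simple ?Cij //.
  by rewrite C_sym Cij.
have [b0 bn] : nonneg b /\ b != 0 by apply: pos; rewrite !mem_cat !inE eqxx orbT.
have [c0 cn] : nonneg c /\ c != 0 by apply: pos; rewrite !mem_cat !inE eqxx !orbT.
have nbc : b != c.
  by move: ul; rewrite !cat_uniq /= !inE !negb_or; case/and5P=> _ _ /and3P[/andP[]].
rewrite /marks !map_cat /= local_intersection6 ?size_map // !sum_not_simple // !det3E.
have SomeE (x y : vec) : (Some x == Some y) = (x == y) by [].
have only x : test b && test c -> test x -> x = b \/ x = c.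
  by move=> /(both b c nbc) [] [-> ->] /orP[]/eqP->; [left|right|right|left].
have hsF : test b && test c -> has test l = false.
  move=> T; apply/hasP => -[x xl /(only x T)]; move: ul xl; rewrite cat_uniq /= !negb_or.
  case/and3P=> _ /and4P[bl _ cl _] _ xl [] E; first by rewrite -E xl in bl.
  by rewrite -E xl in cl.
rewrite !comes_first_cat /comes_first /= !sum_not_simple //= -/(test b) -/(test c).
have := both b c nbc; move: hsF; case Tb : (test b); case Tc : (test c) => /= hsF H.
- rewrite (hsF isT); move: bc; case: (H isT) => // -[-> ->].
    rewrite cartan_form_simplel pairing_simple => ->.
    rewrite !SomeE !eqxx !aij !aji /=.
    by lra.
  rewrite cartan_form_simplel pairing_simple C_sym => ->.
  rewrite !SomeE !eqxx !aij !aji /=.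
  by lra.
- move: Tc => /norP[/negbTE-> /negbTE->]; rewrite !subrr if_same /= ?mulr0n.
  by lra.
- move: Tb => /norP[/negbTE-> /negbTE->]; rewrite !subrr if_same /= ?mulr0n.
  by lra.
move: Tc => /norP[/negbTE-> /negbTE->]; move: Tb => /norP[/negbTE-> /negbTE->].
rewrite !subrr if_same /= ?mulr0n.
by lra.
Qed.

End RootMoveCycles.

(** * Cycles and intersections in a growing weave *)

Fixpoint flow (V : weave) (g : seq nat) : seq nat :=
  if V is v :: V' then flow V' (propagate v g) else g.

Fixpoint flow_intersection (V : weave) (g g' : seq nat) : rat :=
  if V is v :: V' then
    local_intersection v g (propagate v g) g' (propagate v g')
    + flow_intersection V' (propagate v g) (propagate v g')
  else 0.

Definition strands_end (v : vertex) : nat :=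
  match v with Trivalent p => p.+2 | Fourvalent p => p.+2 | Sixvalent p => p.+3 end.

(** Cycles propagate independently of colors, so this bound on positions, for a
    weave with [l] strands at the top, is what relates the cycles of a weave to
    those of its extensions. *)
Fixpoint fits (W : weave) (l : nat) : bool :=
  if W is v :: W' then (strands_end v <= l)%N && fits W' (l - is_trivalent v) else true.

Definition no_trivalent : pred weave := all (fun v => ~~ is_trivalent v).

Lemma count_no_trivalent V : no_trivalent V -> count is_trivalent V = 0%N.
Proof. by elim: V => //= v V IH /andP[/negbTE-> /IH]. Qed.

Lemma fits_cat W V l : fits (W ++ V) l = fits W l && fits V (l - count is_trivalent W).
Proof.
elim: W l => [|v W IH] l /=; first by rewrite subn0.
by rewrite IH subnDA andbA.
Qed.

Lemma size_propagate v g : (strands_end v <= size g)%N ->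
  size (propagate v g) = (size g - is_trivalent v)%N.
Proof.
case: v => p /= le; rewrite /propagate size_cat /= size_drop size_take; case: ltnP; lia.
Qed.

Lemma take_nseq_zero p l : take p (nseq l 0%N) = nseq (minn p l) 0%N.
Proof.
by elim: l p => [|l IH] [|p] //=; rewrite IH minnSS.
Qed.

Lemma nth_nseq_zero p l : nth 0%N (nseq l 0%N) p = 0%N.
Proof. by rewrite nth_nseq if_same. Qed.

Lemma propagate_zero v l : (strands_end v <= l)%N ->
  propagate v (nseq l 0%N) = nseq (l - is_trivalent v) 0%N.
Proof.
move=> le; apply: (@eq_from_nth _ 0%N); rewrite size_propagate ?size_nseq // => k _.
rewrite nth_nseq_zero; case: v le => p /= le; rewrite /propagate !nth_nseq_zero;
  rewrite nth_cat take_nseq_zero size_nseq nth_nseq_zero drop_nseq;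
  by case: ifP => // _; case: (k - _)%N => [|[|[|m]]] //=; rewrite nth_nseq_zero.
Qed.

Lemma local_intersection_zerol v l m g g' :
  local_intersection v (nseq l 0%N) (nseq m 0%N) g g' = 0.
Proof.
case: v => p //=; rewrite /local_intersection !nth_nseq_zero !det3E; first by ring.
by rewrite -[RHS](mulr0 2^-1); congr (_ * _); ring.
Qed.

Lemma local_intersection_zeror v l m g g' :
  local_intersection v g g' (nseq l 0%N) (nseq m 0%N) = 0.
Proof.
case: v => p //=; rewrite /local_intersection !nth_nseq_zero !det3E; first by ring.
by rewrite -[RHS](mulr0 2^-1); congr (_ * _); ring.
Qed.

Lemma flow_zero V l : no_trivalent V -> fits V l -> flow V (nseq l 0%N) = nseq l 0%N.
Proof.
elim: V => //= v V IH /andP[/negbTE nt ntV] /andP[le fV].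
by rewrite propagate_zero // nt subn0 in fV *; rewrite IH.
Qed.

Lemma flow_intersection_zerol V l g : no_trivalent V -> fits V l ->
  flow_intersection V (nseq l 0%N) g = 0.
Proof.
elim: V g => //= v V IH g /andP[/negbTE nt ntV] /andP[le fV].
rewrite propagate_zero // nt subn0 in fV *.
by rewrite local_intersection_zerol IH // addr0.
Qed.

Lemma flow_intersection_zeror V l g : no_trivalent V -> fits V l ->
  flow_intersection V g (nseq l 0%N) = 0.
Proof.
elim: V g => //= v V IH g /andP[/negbTE nt ntV] /andP[le fV].
rewrite propagate_zero // nt subn0 in fV *.
by rewrite local_intersection_zeror IH // addr0.
Qed.

Section Moves.

Context (n : nat) (C : 'M[int]_n.+1).
Context (C_diag : forall i, C i i = 2).
Context (C_sym : forall i j, C i j = C j i).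
Context (C_off : forall i j, i != j -> C i j = 0 \/ C i j = -1).

Notation alpha := (@simple_root n).

Lemma is_weave_cons v V s s' : is_weave C (v :: V) s s' ->
  exists2 s1, apply_vertex C v s = Some s1 & is_weave C V s1 s'.
Proof.
have none V' : foldl (fun o v => obind (apply_vertex C v) o) None V' = None by elim: V'.
rewrite /is_weave; cbn [foldl obind oapp].
by case: apply_vertex => [s1|]; [exists s1 | rewrite none].
Qed.

Lemma apply_vertex_fits v s s1 : apply_vertex C v s = Some s1 -> (strands_end v <= size s)%N.
Proof.
have lt p (u t : seq 'I_n.+1) : drop p s = u ++ t -> (0 < size u)%N -> (p + size u <= size s)%N.
  by move=> /(congr1 size); rewrite size_drop size_cat; lia.
case: v => p /=; case E: drop => [|i [|j u]] // H.
- by rewrite -addn2; apply: (lt p [:: i; j] u).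
- by rewrite -addn2; apply: (lt p [:: i; j] u).
case: u E H => // k u E _.
by rewrite -addn3; apply: (lt p [:: i; j; k] u).
Qed.

Lemma is_weave_fits V s s' : no_trivalent V -> is_weave C V s s' ->
  fits V (size s) /\ size s' = size s.
Proof.
elim: V s => [|v V IH] s /=; first by move=> _ [->].
case/andP=> nt ntV /is_weave_cons[s1 E /(IH _ ntV)[fV ->]].
have sz : size s1 = size s.
  have le := apply_vertex_fits E; case: v nt le E => //= p _ le.
    case Ed: drop => [|i [|j u]] //; case: ifP => // _ [<-].
    rewrite -{2}(cat_take_drop p s) Ed; by rewrite !size_cat.
  case Ed: drop => [|i [|j [|k u]]] //; case: ifP => // _ [<-].
  by rewrite -{2}(cat_take_drop p s) Ed !size_cat.
by rewrite (apply_vertex_fits E) (negbTE nt) subn0 -sz.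
Qed.

(** The contributions of the vertices telescope: the total only depends on the
    two ends of the stretch of moves, and in particular not on the choice of the
    moves. *)
Lemma moves_cycles V s s' : no_trivalent V -> is_weave C V s s' -> reduced C s ->
  [/\ reduced C s', word_mx C s' = word_mx C s, perm_eq (root_seq C s) (root_seq C s'),
      forall i, flow V (marks (alpha i) (root_seq C s)) = marks (alpha i) (root_seq C s') &
      forall i j, i != j ->
        let a := alpha i in let b := alpha j in
        flow_intersection V (marks a (root_seq C s)) (marks b (root_seq C s)) =
        if C i j == -1
        then (comes_first a b (root_seq C s'))%:R - (comes_first a b (root_seq C s))%:R else 0].
Proof.
elim: V s => [|v V IH] s /=.
  by move=> _ [->] red; split=> // i j _; rewrite subrr if_same.
case/andP=> nt ntV /is_weave_cons[s1 E WV] red.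
have [w1 sz1 mv] := move_roots C_diag C_sym nt E.
have red1 : reduced C s1 by apply: reduced_same red w1 _; rewrite sz1.
have [red' w' perm' fl flI] := IH _ ntV WV red1.
have u := root_seq_uniq C_diag C_sym C_off red.
have pos b : b \in root_seq C s -> nonneg b /\ b != 0.
  move=> bs; split; first exact: (root_seq_nonneg C_diag C_sym C_off red).
  by have [x [i [y [_ ->]]]] := mem_root_seq bs; apply: root_neq0.
split=> // [||i|i j ij].
- by rewrite w'.
- exact: perm_trans (root_move_perm mv) perm'.
- by rewrite (root_move_marks _ mv u pos).
rewrite !(root_move_marks _ mv u pos) (root_move_intersection C_sym mv u pos ij) flI //.
by case: ifP => _; rewrite ?addr0 // addrC addrA subrK.
Qed.

End Moves.

Definition bottom_cycle (W : weave) (l k : nat) : seq nat := lusztig_cycle W l k (size W).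

Lemma lusztig_cycle_cat W V l k m : (m <= size W)%N ->
  lusztig_cycle (W ++ V) l k m = lusztig_cycle W l k m.
Proof.
elim: m => //= m IH lt; rewrite IH 1?ltnW //.
by rewrite /vertex_at nth_cat lt.
Qed.

Lemma bottom_cycle_rcons W v l k : bottom_cycle (rcons W v) l k =
  let g := propagate v (bottom_cycle W l k) in
  if v is Trivalent p then (if size W == k then set_nth 0%N g p 1%N else g) else g.
Proof.
rewrite /bottom_cycle size_rcons /= -cats1 lusztig_cycle_cat //.
by rewrite /vertex_at nth_cat ltnn subnn.
Qed.

Lemma intersection_rcons W v l k k' : intersection (rcons W v) l k k' =
  intersection W l k k' + local_intersection v
    (bottom_cycle W l k) (bottom_cycle (rcons W v) l k)
    (bottom_cycle W l k') (bottom_cycle (rcons W v) l k').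
Proof.
rewrite /intersection /bottom_cycle size_rcons big_nat_recr //=; congr (_ + _).
  apply: eq_big_nat => m /andP[_ lt]; rewrite -cats1 /vertex_at nth_cat lt.
  by rewrite !lusztig_cycle_cat // ltnW.
by rewrite -cats1 !(lusztig_cycle_cat _ _ _ (leqnn _)) /vertex_at nth_cat ltnn subnn.
Qed.

Lemma bottom_cycle_rcons_old W v l k : ~~ is_trivalent v \/ (k < size W)%N ->
  bottom_cycle (rcons W v) l k = propagate v (bottom_cycle W l k).
Proof.
rewrite bottom_cycle_rcons; case: v => [p|p|p] //= [//|lt].
by rewrite gtn_eqF.
Qed.

Lemma flow_rcons V v g : flow (rcons V v) g = propagate v (flow V g).
Proof. by elim: V g => //= u V IH g; rewrite IH. Qed.

Lemma flow_intersection_rcons V v g g' : flow_intersection (rcons V v) g g' =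
  flow_intersection V g g' +
  local_intersection v (flow V g) (propagate v (flow V g)) (flow V g') (propagate v (flow V g')).
Proof.
by elim: V g g' => [|u V IH] g g' /=; rewrite ?add0r ?addr0 // IH addrA.
Qed.

Lemma bottom_cycle_moves W V l k : no_trivalent V ->
  bottom_cycle (W ++ V) l k = flow V (bottom_cycle W l k).
Proof.
elim/last_ind: V => [|V v IH]; first by rewrite cats0.
rewrite /no_trivalent all_rcons => /andP[nt ntV].
by rewrite -rcons_cat bottom_cycle_rcons_old ?IH ?flow_rcons; auto.
Qed.

Lemma intersection_moves W V l k k' : no_trivalent V ->
  intersection (W ++ V) l k k' =
  intersection W l k k' + flow_intersection V (bottom_cycle W l k) (bottom_cycle W l k').
Proof.
elim/last_ind: V => [|V v IH]; first by rewrite cats0 addr0.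
rewrite /no_trivalent all_rcons => /andP[nt ntV].
rewrite -rcons_cat intersection_rcons IH // flow_intersection_rcons addrA.
by rewrite !bottom_cycle_rcons_old ?bottom_cycle_moves; auto.
Qed.

Lemma bottom_cycle_unborn W l k : fits W l -> (size W <= k)%N ->
  bottom_cycle W l k = nseq (l - count is_trivalent W) 0%N.
Proof.
elim/last_ind: W => [|W v IH]; first by rewrite subn0.
rewrite -cats1 fits_cat cats1 size_rcons /= andbT => /andP[fW fv] lt.
rewrite bottom_cycle_rcons IH 1?ltnW // propagate_zero //.
rewrite -cats1 count_cat /= addn0 subnDA (ltn_eqF lt).
by case: (v).
Qed.

Lemma intersection_unbornr W l k k' : fits W l -> (size W <= k')%N -> intersection W l k k' = 0.
Proof.
elim/last_ind: W => [|W v IH]; first by rewrite /intersection big_nil.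
move=> fits_; have := fits_; rewrite -{1}cats1 fits_cat size_rcons /= andbT => /andP[fW fv] lt.
rewrite intersection_rcons IH // 1?ltnW // add0r.
rewrite (@bottom_cycle_unborn W l k') // 1?ltnW // (@bottom_cycle_unborn _ l k') ?size_rcons //.
exact: local_intersection_zeror.
Qed.

Lemma size_bottom_cycle W l k : fits W l ->
  size (bottom_cycle W l k) = (l - count is_trivalent W)%N.
Proof.
elim/last_ind: W => [|W v IH]; first by rewrite size_nseq subn0.
rewrite -{1}cats1 fits_cat /= andbT => /andP[fW fv].
rewrite bottom_cycle_rcons -cats1 count_cat /= addn0 subnDA -(IH fW) in fv *.
have := size_propagate fv; case: v fv => p //= le E.
case: ifP => _ //; rewrite size_set_nth E; lia.
Qed.

(** A strand added from top to bottom carries the value 0 of every cycle. *)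
Definition add_zero (X : side) (g : seq nat) : seq nat :=
  if X is Lft then 0%N :: g else rcons g 0%N.

Definition shift_on (X : side) (v : vertex) : vertex :=
  if X is Lft then shift_vertex v else v.

Lemma shift_weave_rcons X W v :
  shift_weave X (rcons W v) = rcons (shift_weave X W) (shift_on X v).
Proof. by case: X => //=; rewrite map_rcons. Qed.

Lemma size_shift_weave X W : size (shift_weave X W) = size W.
Proof. by case: X => //=; rewrite size_map. Qed.

Lemma count_shift_weave X W :
  count is_trivalent (shift_weave X W) = count is_trivalent W.
Proof. by case: X => //=; rewrite count_map; apply: eq_count; case. Qed.

Lemma fits_shift_weave X W l : fits W l -> fits (shift_weave X W) l.+1.
Proof.
case: X; elim: W l => //= v W IH l /andP[le fW].
  have -> : (strands_end (shift_vertex v) <= l.+1)%N by case: v le {fW}.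
  have -> : (l.+1 - is_trivalent (shift_vertex v) = (l - is_trivalent v).+1)%N.
    by case: v le {fW} => p //=; lia.
  exact: IH.
have -> : (l.+1 - is_trivalent v = (l - is_trivalent v).+1)%N.
  by case: v le {fW} => p //=; lia.
by rewrite (leq_trans le) //= IH.
Qed.

Lemma nth_rcons_zero g i : nth 0%N (rcons g 0%N) i = nth 0%N g i.
Proof.
rewrite nth_rcons; case: ltnP => // le.
by rewrite if_same nth_default.
Qed.

Lemma propagate_add_zero X v g : (strands_end v <= size g)%N ->
  propagate (shift_on X v) (add_zero X g) = add_zero X (propagate v g).
Proof.
case: X; first by case: v.
case: v => p /= le; rewrite /propagate !nth_rcons_zero rcons_cat /=;
  rewrite -cats1 takel_cat; (try lia); rewrite cats1 drop_rcons //; lia.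
Qed.

Lemma local_intersection_add_zero X v g1 g1' g2 g2' :
  local_intersection (shift_on X v) (add_zero X g1) (add_zero X g1')
    (add_zero X g2) (add_zero X g2') = local_intersection v g1 g1' g2 g2'.
Proof.
case: X; first by case: v.
by case: v => p; rewrite /local_intersection //= !nth_rcons_zero.
Qed.

Lemma bottom_cycle_shift X W l k : fits W l ->
  bottom_cycle (shift_weave X W) l.+1 k = add_zero X (bottom_cycle W l k).
Proof.
elim/last_ind: W => [|W v IH].
  case: X => //= _; rewrite /bottom_cycle /=.
  by elim: l => //= l <-.
rewrite -{1}cats1 fits_cat /= andbT => /andP[fW fv].
rewrite shift_weave_rcons !bottom_cycle_rcons IH // size_shift_weave.
have {}fv : (strands_end v <= size (bottom_cycle W l k))%N by rewrite size_bottom_cycle.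
rewrite propagate_add_zero //; have := size_propagate fv.
move: fv {IH}; case: v => p //=; [|by case: X|by case: X].
case: X => /= fv sz; case: ifP => // _; rewrite set_nthE [in RHS]set_nthE /=.
rewrite size_rcons; have lt : (p < size (propagate (Trivalent p) (bottom_cycle W l k)))%N by lia.
rewrite lt (leq_trans lt) // rcons_cat /= -cats1 takel_cat 1?ltnW // cats1 drop_rcons //.
Qed.

Lemma intersection_shift X W l k k' : fits W l ->
  intersection (shift_weave X W) l.+1 k k' = intersection W l k k'.
Proof.
elim/last_ind: W => [|W v IH]; first by rewrite /intersection; case: X => _; rewrite /= !big_geq.
move=> fits_; have := fits_; rewrite -{1}cats1 fits_cat /= andbT => /andP[fW fv].
rewrite shift_weave_rcons !intersection_rcons IH // -shift_weave_rcons.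
by rewrite !bottom_cycle_shift // local_intersection_add_zero.
Qed.

Lemma bottom_cycle_prefix V W l k : no_trivalent V -> fits V l ->
  bottom_cycle (V ++ W) l (size V + k) = bottom_cycle W l k.
Proof.
move=> nt fV; elim/last_ind: W => [|W v IH].
  by rewrite cats0 bottom_cycle_unborn ?leq_addr // count_no_trivalent // subn0.
by rewrite -rcons_cat !bottom_cycle_rcons IH size_cat eqn_add2l.
Qed.

Lemma intersection_prefix V W l k k' : no_trivalent V -> fits V l ->
  intersection (V ++ W) l (size V + k) (size V + k') = intersection W l k k'.
Proof.
move=> nt fV; elim/last_ind: W => [|W v IH].
  by rewrite cats0 intersection_unbornr ?leq_addr // /intersection big_geq.
by rewrite -rcons_cat !intersection_rcons IH rcons_cat !bottom_cycle_prefix.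
Qed.

Lemma trivalent_indices_rcons W v : trivalent_indices (rcons W v) =
  if is_trivalent v then rcons (trivalent_indices W) (size W) else trivalent_indices W.
Proof.
rewrite /trivalent_indices size_rcons -addn1 iotaD filter_cat /= add0n.
have -> : is_trivalent (vertex_at (rcons W v) (size W)) = is_trivalent v.
  by rewrite /vertex_at nth_rcons ltnn eqxx.
have -> : [seq k <- iota 0 (size W) | is_trivalent (vertex_at (rcons W v) k)]
        = [seq k <- iota 0 (size W) | is_trivalent (vertex_at W k)].
  apply: eq_in_filter => k; rewrite mem_iota add0n /vertex_at nth_rcons => /andP[_ ->] //.
by case: ifP => _; rewrite ?cats0 ?cats1.
Qed.

Lemma trivalent_indices_moves W V : no_trivalent V ->
  trivalent_indices (W ++ V) = trivalent_indices W.
Proof.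
elim/last_ind: V => [|V v IH]; first by rewrite cats0.
rewrite /no_trivalent all_rcons => /andP[nt ntV].
by rewrite -rcons_cat trivalent_indices_rcons (negbTE nt) IH.
Qed.

Lemma trivalent_indices_shift X W : trivalent_indices (shift_weave X W) = trivalent_indices W.
Proof.
elim/last_ind: W => [|W v IH]; first by case: X.
rewrite shift_weave_rcons !trivalent_indices_rcons IH size_shift_weave.
by case: (X); case: v.
Qed.

Lemma trivalent_indices_prefix V W : no_trivalent V ->
  trivalent_indices (V ++ W) = [seq (size V + k)%N | k <- trivalent_indices W].
Proof.
move=> nt; elim/last_ind: W => [|W v IH].
  by rewrite cats0 -[V]/([::] ++ V) trivalent_indices_moves.
rewrite -rcons_cat !trivalent_indices_rcons IH size_cat; case: ifP => // _.
by rewrite map_rcons.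
Qed.

Lemma size_trivalent_indices W : size (trivalent_indices W) = count is_trivalent W.
Proof.
elim/last_ind: W => // W v IH; rewrite trivalent_indices_rcons.
rewrite -[in RHS]cats1 count_cat /= addn0 -IH.
by case: ifP => _; rewrite ?size_rcons ?addn1 ?addn0.
Qed.

Lemma local_intersection_anti v g1 g1' g2 g2' :
  local_intersection v g1 g1' g2 g2' = - local_intersection v g2 g2' g1 g1'.
Proof.
case: v => p; rewrite /local_intersection ?oppr0 ?det3E //; ring.
Qed.

Lemma intersection_anti W l k k' : intersection W l k k' = - intersection W l k' k.
Proof.
rewrite /intersection -sumrN; apply: eq_bigr => m _.
exact: local_intersection_anti.
Qed.

(** * The cycles of a double inductive weave *)

(** The sign of the intersection of the cycle that dies at a merge with the one
    that is born there. *)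
Definition side_sign (X : side) : rat := if X is Rgt then 1 else -1.

Section Merge.

Context (X : side) (N : nat) (N_gt0 : (0 < N)%N).
Let p := merge_position X N.

Lemma merge_position_lt : (p < N)%N.
Proof. by rewrite /p; case: X => //=; lia. Qed.

(** The new strand has value 0, so that the minimum in the 3-valent vertex
    erases the value of the outermost strand. *)
Lemma propagate_merge g : size g = N ->
  propagate (Trivalent p) (add_zero X g) = set_nth 0%N g p 0%N.
Proof.
rewrite /p => sz; case: X => /=.
  by case: g sz N_gt0 => [<-//|x g _ _]; rewrite /propagate /= min0n drop0.
have lt : (N.-1 < N)%N by lia.
rewrite /propagate !nth_rcons_zero [nth _ g N.-1.+1]nth_default ?minn0; last by lia.
rewrite drop_oversize ?size_rcons; last by lia.
rewrite set_nthE sz lt drop_oversize; last by lia.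
by rewrite -cats1 takel_cat // sz; lia.
Qed.

(** Both cycles take the value 0 on the new strand and below the vertex, so that
    the last two rows of the determinant are proportional. *)
Lemma local_intersection_merge_old g g' : size g = N -> size g' = N ->
  local_intersection (Trivalent p) (add_zero X g) (set_nth 0%N g p 0%N)
    (add_zero X g') (set_nth 0%N g' p 0%N) = 0.
Proof.
move=> sz sz'; rewrite /local_intersection !nth_set_nth /= !eqxx /p; case: X => /=.
  by rewrite det3E; ring.
rewrite !nth_rcons_zero [nth _ g' N.-1.+1]nth_default; last by lia.
by rewrite [nth _ g N.-1.+1]nth_default ?det3E; [ring | lia].
Qed.

Lemma local_intersection_merge_new g g' : size g = N ->
  local_intersection (Trivalent p) (add_zero X g) (set_nth 0%N g p 0%N)
    (add_zero X (nseq N 0%N)) (set_nth 0%N g' p 1%N) =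
  side_sign X * (nth 0%N g p)%:R.
Proof.
move=> sz; rewrite /local_intersection !nth_set_nth /= !eqxx /p; case: X => /=.
  by rewrite nth_nseq_zero det3E /side_sign; ring.
rewrite !nth_rcons_zero !nth_nseq_zero [nth _ g N.-1.+1]nth_default; last by lia.
by rewrite det3E /side_sign; ring.
Qed.

End Merge.

Section Marks.

Context (n : nat).
Notation vec := 'cV[int]_n.+1.
Implicit Types (a b : vec) (l : seq vec).

Lemma nth_marks a l p : (p < size l)%N -> nth 0%N (marks a l) p = (nth 0 l p == a).
Proof. by move=> lt; rewrite (nth_map 0). Qed.

Lemma marks_clear a l p : uniq l -> (p < size l)%N ->
  set_nth 0%N (marks a l) p 0%N =
  if a == nth 0 l p then nseq (size l) 0%N else marks a l.
Proof.
move=> ul lt; apply: (@eq_from_nth _ 0%N).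
  by rewrite size_set_nth size_marks; case: ifP => _; rewrite ?size_nseq ?size_marks; lia.
move=> k; rewrite size_set_nth size_marks (maxn_idPr lt) => lek; rewrite nth_set_nth /=.
case: eqVneq => [->|kp].
  case: eqVneq => [_|ap]; first by rewrite nth_nseq_zero.
  by rewrite nth_marks // eq_sym (negbTE ap).
case: ifP => [/eqP->|//]; rewrite nth_nseq_zero nth_marks // nth_uniq //.
by rewrite (negbTE kp).
Qed.

Lemma marks_newborn l p : uniq l -> (p < size l)%N ->
  set_nth 0%N (nseq (size l) 0%N) p 1%N = marks (nth 0 l p) l.
Proof.
move=> ul lt; apply: (@eq_from_nth _ 0%N); first by rewrite size_set_nth size_marks size_nseq; lia.
move=> k; rewrite size_set_nth size_nseq (maxn_idPr lt) => lek.
by rewrite nth_set_nth /= nth_nseq_zero nth_marks // nth_uniq //; case: eqP.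
Qed.

Lemma comes_first_single a b l : a \in l -> b \notin l ->
  comes_first a b l /\ comes_first b a l = false.
Proof.
move=> al bl; have SomeE (x y : vec) : (Some x == Some y) = (x == y) by [].
have filt (P : pred vec) : (forall x, P x = (x == a) || (x == b)) ->
    exists2 s, [seq v <- l | P v] = a :: s & a != b.
  move=> PE; case E: [seq v <- l | P v] => [|y s].
    by have : a \in [::] by rewrite -E mem_filter PE eqxx.
  have : y \in [seq v <- l | P v] by rewrite E mem_head.
  rewrite mem_filter PE => /andP[/orP[]/eqP-> yl].
    by exists s => //; apply: contraNneq bl => <-.
  by rewrite yl in bl.
rewrite /comes_first; have [//|s -> ab] := filt (fun v => (v == a) || (v == b)).
have [|s' -> _] := filt (fun v => (v == b) || (v == a)); first by move=> x; rewrite orbC.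
by rewrite /= !SomeE eqxx (negbTE ab).
Qed.

Lemma set_nth_nseq_zero N p : (p < N)%N -> set_nth 0%N (nseq N 0%N) p 0%N = nseq N 0%N.
Proof.
move=> lt; apply: (@eq_from_nth _ 0%N); first by rewrite size_set_nth size_nseq; lia.
by move=> k _; rewrite nth_set_nth /= nth_nseq_zero if_same.
Qed.

Definition add_root (X : side) (b : vec) (l : seq vec) : seq vec :=
  if X is Lft then b :: l else rcons l b.

(** This fixes the order of two strands at the moments when one of them is born
    or merged. *)
Lemma comes_first_add_root X a b l : uniq (add_root X b l) -> a != b -> a \in add_root X b l ->
  comes_first a b (add_root X b l) = is_right X /\
  comes_first b a (add_root X b l) = ~~ is_right X.
Proof.
have SomeE (x y : vec) : (Some x == Some y) = (x == y) by [].
case: X => /=.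
  by move=> _ ab _; rewrite /comes_first /= eqxx orbT /= !SomeE eqxx eq_sym (negbTE ab).
rewrite rcons_uniq mem_rcons inE => /andP[bl _] ab; rewrite (negbTE ab) /= => al.
have [c1 c2] := comes_first_single al bl.
have hasl (P : pred vec) : P a -> has P l by move=> Pa; apply/hasP; exists a.
by rewrite -cats1 !comes_first_cat !hasl ?eqxx ?orbT.
Qed.

Lemma nth_add_root X b l : nth 0 (add_root X b l) (merge_position X (size l).+1) = b.
Proof. by case: X => //=; rewrite nth_rcons ltnn eqxx. Qed.

End Marks.

Section DoubleInductive.

Context (n : nat) (C : 'M[int]_n.+1).
Context (C_diag : forall i, C i i = 2).
Context (C_sym : forall i j, C i j = C j i).
Context (C_off : forall i j, i != j -> C i j = 0 \/ C i j = -1).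
Context (w0 : weyl C) (lg : longest w0).
Context (D : seq 'I_n.+1) (redD : reduced C D) (Dw : word_mx C D = w0).
Context (hx : seq ('I_n.+1 * side)).

Notation alpha := (@simple_root n).

Let r := size hx.
Let h := [seq x.1 | x <- hx].
Let nx := next_pos h.
Let X t := nth Rgt [seq x.2 | x <- hx] t.-1.
Let a p := alpha (star w0 (letter h p)).

(** On the right the strand of a color [i] has the root [- w0 alpha_i], which is
    the simple root of the starred color.  The star on the left gives the new
    strand the same root there. *)
Definition string_letter (x : 'I_n.+1 * side) : 'I_n.+1 * side :=
  (if x.2 is Lft then star w0 x.1 else x.1, x.2).

Definition lifted_string (xs : double_string n) : double_string n :=
  [seq (j, Rgt) | j <- D] ++ xs.

Lemma string_word_rcons (ds : double_string n) x :
  string_word (rcons ds x) = add_strand (string_word ds) x.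
Proof. by rewrite /string_word foldl_rcons. Qed.

Lemma string_word_right s : string_word [seq (j, Rgt) | j : 'I_n.+1 <- s] = s.
Proof. by elim/last_ind: s => // s i IH; rewrite map_rcons string_word_rcons IH. Qed.

Lemma string_word_lifted xs : exists u v, string_word (lifted_string xs) = u ++ D ++ v.
Proof.
elim/last_ind: xs => [|xs x [u [v IH]]].
  by exists [::], [::]; rewrite /lifted_string cats0 string_word_right cats0.
rewrite /lifted_string -rcons_cat string_word_rcons IH /add_strand; case: x.2.
  by exists (x.1 :: u), v.
by exists u, (rcons v x.1); rewrite -!rcons_cat.
Qed.

Lemma double_inductive_rcons ds x W s : double_inductive C (rcons ds x) W s ->
  exists W1 s1, double_inductive C ds W1 s1 /\
    ([/\ (weyl_length (demazure C (string_word ds))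
          < weyl_length (demazure C (string_word (rcons ds x))))%N,
         W = shift_weave x.2 W1 & s = add_strand s1 x] \/
     exists V s', [/\ (weyl_length (demazure C (string_word (rcons ds x)))
          <= weyl_length (demazure C (string_word ds)))%N,
         no_trivalent V, is_weave C V s1 s, s = add_strand s' x &
         W = rcons (shift_weave x.2 (W1 ++ V)) (Trivalent (merge_position x.2 (size s)))]).
Proof.
move E: (rcons ds x) => ds' H; case: H E => [|ds0 W1 s1 x0 H lt|ds0 W1 s1 x0 V s' H le nt WV].
- by case: ds.
- by move/rcons_inj => [-> ->]; exists W1, s1; split=> //; left.
by move/rcons_inj => [-> ->]; exists W1, s1; split=> //; right; exists V, s'.
Qed.

(** Along a reduced word the Demazure product grows at each letter, so that no
    vertex is created. *)
Lemma double_inductive_reduced s W s' : reduced C s ->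
  double_inductive C [seq (j, Rgt) | j <- s] W s' -> W = [::] /\ s' = s.
Proof.
elim/last_ind: s W s' => [|s i IH] W s' red; rewrite ?map_rcons /=.
  move E: ([::]) => ds H; case: H E => //= [ds0 W1 s1 x0 _ _|ds0 W1 s1 x0 V s'' _ _ _ _];
    by case: ds0.
case/double_inductive_rcons=> W1 [s1 [/IH[|-> ->]]]; first exact: reduced_rcons_prefix red.
case=> [[_ -> ->]|[V [s'' []]]] //.
rewrite string_word_rcons string_word_right /add_strand /=.
have reds := reduced_rcons_prefix red.
rewrite (reduced_weyl_length red); last by rewrite demazure_reduced.
rewrite (reduced_weyl_length reds); last by rewrite demazure_reduced.
by rewrite size_rcons ltnn.
Qed.

Let size_h : size h = r. Proof. exact: size_map. Qed.

Lemma alive_letter p t : (0 < p <= t)%N -> (t < nx p)%N -> (t < r)%N ->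
  (letter h p == letter h t.+1) = (nx p == t.+1).
Proof.
move=> pt tn tr; apply/eqP/eqP => [E|E]; last by rewrite -E next_pos_letter // size_h -/nx E.
have [//|ne] := eqVneq (nx p) t.+1.
have := @next_pos_between _ h p t.+1; rewrite E eqxx size_h => H; exfalso.
by suff: false by []; apply: H; rewrite -/nx; lia.
Qed.

(** The intersection of the cycles of [p < q] in the weave of the first [t]
    letters, with bottom slice [s].  As long as both cycles live, the order of
    their strands in [s] is compared with their order at the birth of [q]; after
    the end of their common life the former is the order at that end. *)
Definition expected_intersection (t : nat) (s : seq 'I_n.+1) (p q : nat) : rat :=
  if (nx p <= q)%N then (if nx p == q then side_sign (X q) else 0)
  else if C (letter h p) (letter h q) == -1 then
    (if (t < minn (nx p) (nx q))%N then comes_first (a p) (a q) (root_seq C s)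
     else if (nx p < nx q)%N then ~~ is_right (X (nx p)) else is_right (X (nx q)))%:R
    - (is_right (X q))%:R
  else 0.

Definition birth (W : weave) (t : nat) : nat := nth 0%N (trivalent_indices W) t.-1.

Lemma birth_lt W t : (0 < t <= count is_trivalent W)%N -> (birth W t < size W)%N.
Proof.
move=> /andP[t0 le]; have : birth W t \in trivalent_indices W.
  by apply: mem_nth; rewrite size_trivalent_indices; lia.
by rewrite mem_filter mem_iota => /and3P[].
Qed.

(** [a p] is the simple root of the starred color of [p], and [W] is the weave of
    the first [t] letters after those of [D]. *)
Record slice_invariant (t : nat) (W : weave) (s : seq 'I_n.+1) : Prop := SliceInvariant {
  inv_reduced : reduced C s;
  inv_word : word_mx C s = w0;
  inv_size : size s = size D;
  inv_count : count is_trivalent W = t;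
  inv_fits : fits W (size D + t);
  inv_cycle p : (0 < p <= t)%N ->
    bottom_cycle W (size D + t) (birth W p) =
    if (t < nx p)%N then marks (a p) (root_seq C s) else nseq (size D) 0%N;
  inv_alive p : (0 < p <= t)%N -> (t < nx p)%N -> a p \in root_seq C s;
  inv_intersection p q : (0 < p < q)%N -> (q <= t)%N ->
    intersection W (size D + t) (birth W p) (birth W q) = expected_intersection t s p q }.

Lemma slice_invariant0 : slice_invariant 0 [::] D.
Proof. by split=> // p; lia. Qed.

Lemma alive_neq p q t : (0 < p < q)%N -> (q <= t)%N -> (t <= r)%N -> (t < nx p)%N ->
  star w0 (letter h p) != star w0 (letter h q).
Proof.
move=> pq qt tr tn; rewrite (inj_eq (star_inj C_diag C_sym C_off lg)) eq_sym.
by apply: next_pos_between; rewrite ?size_h -/nx; lia.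
Qed.

(** The moves [V] carry the indicators and change the intersections by the change
    of order; the merge then erases the cycle of the strand with root [b], the
    outermost one on the side of the new letter, and creates the new cycle on the
    same strand. *)
Lemma slice_invariant_step t W s V s' s1 (x := string_letter (nth (ord0, Rgt) hx t)) :
  (t < r)%N -> slice_invariant t W s -> no_trivalent V -> is_weave C V s s1 ->
  s1 = add_strand s' x ->
  slice_invariant t.+1 (rcons (shift_weave x.2 (W ++ V)) (Trivalent (merge_position x.2 (size s1)))) s1.
Proof.
move=> tr [red sw szs cnt fW cyc alive int] nt WV Ds1.
have [fV szs1] := is_weave_fits nt WV.
have [red1 s1w perm1 fl flI] := moves_cycles C_diag C_sym C_off nt WV red.
rewrite szs in fV szs1; rewrite sw in s1w.
set l := (size D + t)%N in fW cyc int.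
set k := letter h t.+1.
have Dx2 : x.2 = X t.+1.
  by rewrite /x /X /string_letter /= (nth_map (ord0, Rgt)).
have Dx1 : x.1 = if X t.+1 is Lft then star w0 k else k.
  by rewrite /x /X /k /letter /string_letter /= !(nth_map (ord0, Rgt)).
clearbody x.
pose b := alpha (star w0 k).
pose Y := x.2.
have size_D : (0 < size D)%N.
  by rewrite -szs1 Ds1 /add_strand; case: x.2; rewrite ?size_rcons.
pose mp := merge_position Y (size D).
have mp_lt : (mp < size D)%N by apply: merge_position_lt.
have [l' Dl'] : exists l', root_seq C s1 = add_root Y b l'.
  rewrite Ds1 /add_strand /Y; case E: x.2.
    exists (strand_roots C (1 * refl C x.1) s') => /=.
    by rewrite /root_seq /= mul1mx /b Dx1 -Dx2 E.
  exists (root_seq C s'); rewrite root_seq_rcons /= /b simple_root_star //.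
  rewrite -s1w Ds1 /add_strand E mulmx_rcons // Dx1 -Dx2 E refl_self // mulmxN opprK //.
have sz_l' : (size l').+1 = size D.
  by rewrite -szs1 -(size_root_seq C) Dl' /add_root; case: (Y); rewrite ?size_rcons.
have nth_b : nth 0 (root_seq C s1) mp = b by rewrite /mp Dl' -sz_l' nth_add_root.
have u1 := root_seq_uniq C_diag C_sym C_off red1.
set W1 := W ++ V.
have ntV := count_no_trivalent nt.
have fW1 : fits W1 l by rewrite fits_cat fW cnt /l addnK.
have cnt1 : count is_trivalent W1 = t by rewrite count_cat ntV addn0.
have birth1 p : birth W1 p = birth W p by rewrite /birth trivalent_indices_moves.
have cyc1 p : (0 < p <= t)%N -> bottom_cycle W1 l (birth W p) =
    if (t < nx p)%N then marks (a p) (root_seq C s1) else nseq (size D) 0%N.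
  move=> lep; rewrite bottom_cycle_moves // cyc //; case: ifP => _; first exact: fl.
  exact: flow_zero.
set v := Trivalent _; set W3 := rcons _ v.
have Dv : v = Trivalent mp by rewrite /v szs1.
have birth3 p : (0 < p <= t)%N -> birth W3 p = birth W p.
  move=> lep; rewrite -(birth1 p) /birth /W3 trivalent_indices_rcons /= trivalent_indices_shift.
  rewrite nth_rcons size_trivalent_indices cnt1; case: ltnP => //; lia.
have birth3n : birth W3 t.+1 = size W1.
  rewrite /birth /W3 trivalent_indices_rcons /= trivalent_indices_shift nth_rcons.
  by rewrite size_trivalent_indices cnt1 ltnn eqxx size_shift_weave.
have birth_lt1 p : (0 < p <= t)%N -> (birth W p < size W1)%N.
  by move=> lep; rewrite -birth1 birth_lt // cnt1.
have size_cyc p : (0 < p <= t)%N -> size (bottom_cycle W1 l (birth W p)) = size D.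
  by move=> _; rewrite size_bottom_cycle // cnt1 addnK.
have zero1 : bottom_cycle W1 l (size W1) = nseq (size D) 0%N.
  by rewrite bottom_cycle_unborn // cnt1 addnK.
have old3 p : (0 < p <= t)%N -> bottom_cycle W3 l.+1 (birth W p) =
    set_nth 0%N (bottom_cycle W1 l (birth W p)) mp 0%N.
  move=> lep; rewrite bottom_cycle_rcons_old ?size_shift_weave ?birth_lt1; auto.
  by rewrite bottom_cycle_shift // Dv propagate_merge ?size_cyc.
have new3 : bottom_cycle W3 l.+1 (size W1) = set_nth 0%N (nseq (size D) 0%N) mp 1%N.
  rewrite bottom_cycle_rcons Dv size_shift_weave /= eqxx bottom_cycle_shift // zero1.
  by rewrite propagate_merge ?size_nseq // set_set_nth eqxx.
have neq_b p : (0 < p <= t)%N -> (t < nx p)%N -> (a p == b) = (nx p == t.+1).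
  move=> lep tn; rewrite /a /b (inj_eq (@simple_root_inj n)).
  by rewrite (inj_eq (star_inj C_diag C_sym C_off lg)) alive_letter.
have alive1 p : (0 < p <= t)%N -> (t < nx p)%N -> a p \in root_seq C s1.
  by move=> lep tn; rewrite -(perm_mem perm1) alive.
have Dl : (size D + t.+1 = l.+1)%N by rewrite addnS.
split=> //.
- by rewrite /W3 -cats1 count_cat count_shift_weave cnt1 addn1.
- rewrite Dl /W3 Dv -cats1 fits_cat fits_shift_weave // count_shift_weave cnt1 /= andbT /l.
  by lia.
- move=> p /andP[p0]; rewrite Dl leq_eqVlt => /orP[/eqP->|].
    rewrite birth3n new3 next_pos_gt ?size_h //.
    by rewrite -szs1 -(size_root_seq C) marks_newborn ?nth_b // size_root_seq szs1.
  rewrite ltnS => ltp; have lep : (0 < p <= t)%N by rewrite p0.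
  rewrite birth3 // old3 // cyc1 //; case: ltnP => [tn|nt']; last first.
    by rewrite ltnNge (leq_trans nt') //= set_nth_nseq_zero.
  rewrite marks_clear ?size_root_seq ?szs1 // nth_b neq_b //.
  by rewrite ltn_neqAle tn andbT eq_sym; case: eqP.
- move=> p /andP[p0]; rewrite leq_eqVlt => /orP[/eqP->|].
    by move=> _; rewrite -[a _]nth_b mem_nth // size_root_seq szs1.
  by rewrite ltnS => ltp /ltnW; apply: alive1; rewrite p0.
move=> p q pq; rewrite Dl leq_eqVlt => /orP[/eqP Dq|].
  subst q; have lep : (0 < p <= t)%N by lia.
  rewrite birth3n birth3 // intersection_rcons intersection_shift // intersection_unbornr //.
  rewrite add0r old3 // new3 !bottom_cycle_shift // zero1 Dv.
  rewrite local_intersection_merge_new ?size_cyc // cyc1 // -/mp /expected_intersection.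
  case: (ltngtP (nx p) t.+1) => cmp.
  - by rewrite /= nth_nseq_zero mulr0.
  - rewrite /= nth_marks ?size_root_seq ?szs1 // nth_b.
    rewrite eq_sym neq_b ?(ltn_trans _ cmp) // gtn_eqF // mulr0.
    rewrite leq_min cmp next_pos_gt ?size_h //=; case: ifP => // _.
    have apb : a p != b by rewrite neq_b ?gtn_eqF // ltnW.
    have := alive1 p lep (ltnW cmp).
    rewrite Dl' => /(comes_first_add_root _ apb) []; first by rewrite -Dl'.
    by rewrite -/b -Dx2 => -> _; rewrite subrr.
  rewrite /= nth_marks ?size_root_seq ?szs1 // nth_b eq_sym neq_b ?cmp // eqxx.
  by rewrite mulr1 /Y Dx2.
rewrite ltnS => qt; have lep : (0 < p <= t)%N by lia.
have leq : (0 < q <= t)%N by lia.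
rewrite !birth3 // intersection_rcons intersection_shift //.
rewrite !old3 // !bottom_cycle_shift // Dv local_intersection_merge_old ?size_cyc // addr0.
rewrite intersection_moves // int // !cyc // /expected_intersection.
set F := flow_intersection _ _ _.
have -> : F = if [&& (t < minn (nx p) (nx q))%N, (q < nx p)%N & C (letter h p) (letter h q) == -1]
    then (comes_first (a p) (a q) (root_seq C s1))%:R - (comes_first (a p) (a q) (root_seq C s))%:R
    else 0.
  rewrite /F leq_min; case: (ltnP t (nx p)) => [tp|_]; last exact: flow_intersection_zerol.
  case: (ltnP t (nx q)) => [tq|_]; last exact: flow_intersection_zeror.
  by rewrite flI ?(alive_neq pq qt (ltnW tr) tp) // cartan_star // (leq_ltn_trans qt tp).
have [npq|qnp] := leqP (nx p) q; first by rewrite andbF addr0.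
have [Cpq|_] := eqVneq (C (letter h p) (letter h q)) (-1); last by rewrite !andbF addr0.
rewrite andbT; case: (ltnP t (minn (nx p) (nx q))) => [tm|mt]; last first.
  by rewrite (ltnNge t.+1) (leq_trans mt) // addr0.
rewrite /= addrC addrA subrK; congr (_ - _).
have [tp tq] : (t < nx p)%N /\ (t < nx q)%N by apply/andP; rewrite -leq_min.
have npq : a p != a q.
  by rewrite (inj_eq (@simple_root_inj n)) (alive_neq pq qt (ltnW tr) tp).
have apb := neq_b p lep tp; have aqb := neq_b q leq tq.
have [tm'|] := ltnP t.+1 (minn (nx p) (nx q)); first by [].
rewrite geq_min => mt.
have [Np|Np] := eqVneq (nx p) t.+1.
  have {}apb : a p = b by apply/eqP; rewrite apb Np.
  have Nq : (t.+1 < nx q)%N.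
    by rewrite ltn_neqAle tq andbT eq_sym -aqb eq_sym -apb.
  rewrite Np Nq apb; congr (_%:R).
  have := alive1 q leq tq; rewrite Dl' => /(comes_first_add_root _) [].
  - by rewrite -Dl'.
  - by rewrite -apb eq_sym.
  by rewrite /Y Dx2 => _ ->.
have Nq : nx q = t.+1 by lia.
have {}aqb : a q = b by apply/eqP; rewrite aqb Nq.
rewrite Nq ltnNge tp /= aqb; congr (_%:R).
have := alive1 p lep tp; rewrite Dl' => /(comes_first_add_root _) [].
- by rewrite -Dl'.
- by rewrite -aqb.
by rewrite /Y Dx2 => -> _.
Qed.

(** As the word contains [D], its Demazure product already is the longest
    element, so that the next letter cannot increase its length and is
    merged. *)
Lemma double_inductive_invariant t W s : (t <= r)%N ->
  double_inductive C (lifted_string [seq string_letter x | x <- take t hx]) W s -> slice_invariant t W s.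
Proof.
elim: t W s => [|t IH] W s tr.
  rewrite take0 /lifted_string cats0 => /(double_inductive_reduced redD)[-> ->].
  exact: slice_invariant0.
rewrite (take_nth (ord0, Rgt)) // map_rcons /lifted_string -rcons_cat.
move=> /double_inductive_rcons[W1 [s1 [/(IH _ _ (ltnW tr)) inv]]].
have dem xs : weyl_mx (demazure C (string_word (lifted_string xs))) = w0.
  by have [u [v ->]] := string_word_lifted xs; apply: demazure_longest.
have len xs : weyl_length (demazure C (string_word (lifted_string xs))) = size D.
  by apply: reduced_weyl_length; rewrite ?dem.
rewrite rcons_cat -map_rcons !len; case=> [[]|[V [s' [_ nt WV Ds ->]]]]; first by rewrite ltnn.
by apply: slice_invariant_step WV Ds.
Qed.

End DoubleInductive.

(** * The quiver of a signed word *)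

Lemma mk_quiver_eq r r' f f' g g' : r = r' ->
  (forall p, (0 < p <= r)%N -> f p = f' p) ->
  (forall p q, (0 < p <= r)%N -> (0 < q <= r)%N -> ~~ (f p && f q) -> g p q = g' p q) ->
  mk_quiver r f g = mk_quiver r' f' g'.
Proof.
move=> <- ff gg; rewrite /mk_quiver; congr Quiver.
  by apply/setP => t; rewrite !inE ff ?ltn_ord.
apply/matrixP => p q; rewrite !mxE -!ff ?ltn_ord //.
by case: ifPn => // nf; apply: gg; rewrite ?ltn_ord.
Qed.

Lemma quiver_op_mk r f g : quiver_op (mk_quiver r f g) = mk_quiver r f (fun p q => g q p).
Proof.
rewrite /quiver_op /mk_quiver /=; congr Quiver; apply/matrixP => p q.
by rewrite !mxE andbC.
Qed.

Section SignedNet.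

Context (n : nat) (C : 'M[int]_n.+1).
Context (C_sym : forall i j, C i j = C j i).
Context (C_off : forall i j, i != j -> C i j = 0 \/ C i j = -1).
Context (sw : signed_word n) (X : nat -> side).

Let h := [seq x.2 | x <- sw].
Let nx := next_pos h.
Local Notation r := (size sw).

Context (sw_signs : forall t, (1 < t <= r)%N ->
  sign_at sw t = if is_right (X t) then -1 else 1).

Let size_h : size h = r. Proof. exact: size_map. Qed.

Lemma signed_exchange_self p : (0 < p <= r)%N -> signed_exchange C sw p p = 0.
Proof.
move=> lep; rewrite /signed_exchange -/h.
have lt : (p < next_pos h p)%N by apply: next_pos_gt; rewrite size_h; lia.
by rewrite (ltn_eqF lt) ltnn !andbF.
Qed.

Lemma signed_exchange_net p q : (0 < p < q)%N -> (q <= r)%N ->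
  ((nx q <= r)%N -> signed_exchange C sw p q = - net_arrows C h X p q) /\
  ((nx p <= r)%N -> signed_exchange C sw q p = net_arrows C h X p q).
Proof.
move=> pq qr; rewrite /signed_exchange /net_arrows -/h -/nx.
have gtp : (p < nx p)%N by apply: next_pos_gt; rewrite size_h; lia.
have gtq : (q < nx q)%N by apply: next_pos_gt; rewrite size_h; lia.
have lep : (nx p <= r.+1)%N by rewrite -size_h next_pos_le.
have leq : (nx q <= r.+1)%N by rewrite -size_h next_pos_le.
have -> : (p == nx q) = false by lia.
have -> : (q < p)%N = false by lia.
have -> : (p < q)%N by lia.
rewrite ?andbF ?andFb (C_sym (letter h q) (letter h p)).
have sq : sign_at sw q = if is_right (X q) then -1 else 1 by apply: sw_signs; lia.
have sp' : (nx p <= r)%N -> sign_at sw (nx p) = if is_right (X (nx p)) then -1 else 1.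
  by move=> le; apply: sw_signs; lia.
have sq' : (nx q <= r)%N -> sign_at sw (nx q) = if is_right (X (nx q)) then -1 else 1.
  by move=> le; apply: sw_signs; lia.
have [npq|qnp] := leqP (nx p) q.
  have -> : (nx p < nx q)%N by lia.
  have -> : (nx q < nx p)%N = false by lia.
  rewrite eq_sym ?andbF ?andbT /=; case: eqP => _ /=; rewrite ?oppr0; last by split.
  by rewrite sq; case: (is_right (X q)).
have -> : (q == nx p) = false by lia.
have nlet : letter h p != letter h q.
  by rewrite eq_sym; apply: next_pos_between; rewrite ?size_h -/nx; lia.
have neq : (nx p <= r)%N \/ (nx q <= r)%N -> nx p != nx q.
  move=> le; apply: contra nlet => /eqP E.
  have l1 : (nx p <= size h)%N by rewrite size_h; case: le; rewrite ?E.
  by rewrite -(next_pos_letter l1) -/nx E next_pos_letter // -/nx -E.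
have [C0|C1] := C_off nlet.
  by rewrite C0 !mulr0 !if_same /= oppr0.
rewrite C1 eqxx.
split=> le.
  have := neq (or_intror le); rewrite neq_ltn; case: (ltnP (nx p) (nx q)) => [lt _|_ /= lt].
    have -> : (nx q < nx p)%N = false by lia.
    rewrite /= ?andbF ?andbT sq sp'; last by lia.
    by case: (is_right (X q)); case: (is_right (X (nx p))).
  rewrite lt /= gtq ?andbF ?andbT /= sq sq' //.
  by case: (is_right (X q)); case: (is_right (X (nx q))).
have := neq (or_introl le); rewrite neq_ltn; case: (ltnP (nx p) (nx q)) => [lt _|_ /= lt].
  have -> : (nx q < nx p)%N = false by lia.
  rewrite /= ?andbF ?andbT sq sp' //.
  by case: (is_right (X q)); case: (is_right (X (nx p))).
rewrite lt /= gtq ?andbF ?andbT /= sq sq'; last by lia.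
by case: (is_right (X q)); case: (is_right (X (nx q))).
Qed.

Lemma signed_frozenE p : signed_frozen sw p = (r < nx p)%N.
Proof. by rewrite /signed_frozen -/h -/nx; have := next_pos_le h p; rewrite size_h -/nx; lia. Qed.

Lemma signed_arrows_self p : (0 < p <= r)%N -> signed_arrows C sw p p = 0.
Proof.
by move=> lep; rewrite /signed_arrows signed_exchange_self // oppr0 maxxx !if_same.
Qed.

Lemma signed_arrows_net p q : (0 < p < q)%N -> (q <= r)%N -> (nx p <= r)%N || (nx q <= r)%N ->
  signed_arrows C sw p q = (Num.max 0 (- net_arrows C h X p q))%:~R /\
  signed_arrows C sw q p = (Num.max 0 (net_arrows C h X p q))%:~R.
Proof.
move=> pq qr nf; have [Epq Eqp] := signed_exchange_net pq qr.
rewrite /signed_arrows !signed_frozenE -!leqNgt.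
case: (leqP (nx q) r) nf Epq => nq; case: (leqP (nx p) r) Eqp => np // Eqp _ Epq.
- by rewrite Epq // Eqp.
- by rewrite Epq // opprK.
by rewrite Eqp.
Qed.

End SignedNet.

(** * Comparison of the quivers *)

Section SignedWeave.

Context (n : nat) (C : 'M[int]_n.+1).
Context (C_diag : forall i, C i i = 2).
Context (C_sym : forall i j, C i j = C j i).
Context (C_off : forall i j, i != j -> C i j = 0 \/ C i j = -1).
Context (w0 : weyl C) (lg : longest w0).
Context (D : seq 'I_n.+1) (redD : reduced C D) (Dw : word_mx C D = w0).
Context (hx : seq ('I_n.+1 * side)) (sw : signed_word n).

Local Notation r := (size hx).
Let h := [seq x.1 | x <- hx].
Let nx := next_pos h.
Let X t := nth Rgt [seq x.2 | x <- hx] t.-1.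

Context (sw_letters : [seq x.2 | x <- sw] = h).
Context (sw_signs : forall t, (1 < t <= r)%N ->
  sign_at sw t = if is_right (X t) then -1 else 1).

Let size_sw : size sw = r.
Proof. by rewrite -(size_map (fun x => x.2) sw) sw_letters size_map. Qed.

(** When one of the two vertices is not frozen, their common life ends before the
    bottom of the weave, and the bottom slice no longer matters. *)
Lemma expected_intersection_end s p q : (minn (nx p) (nx q) <= r)%N ->
  expected_intersection w0 hx r s p q = (net_arrows C h X p q)%:~R.
Proof.
rewrite /expected_intersection /net_arrows -/h -/nx -!/(X _) => le.
case: (leqP (nx p) q) => _; first by case: eqP => // _; case: (X q).
case: ifP => // _; rewrite [(r < _)%N]ltnNge le /=.
by rewrite rmorphB /= !natz.
Qed.

Lemma signed_quiver_weave (w : seq 'I_n.+1) (WT WB : weave) (s : seq 'I_n.+1) :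
  size w = r -> no_trivalent WT -> fits WT (size (D ++ w)) ->
  double_inductive C (lifted_string D [seq string_letter w0 x | x <- hx]) WB s ->
  signed_quiver C sw = quiver_op (weave_quiver (D ++ w) (WT ++ WB)).
Proof.
move=> sz_w ntT fT; rewrite -[hx in X in double_inductive _ X](take_size hx).
move=> /(double_inductive_invariant C_diag C_sym C_off lg redD Dw (leqnn _)) inv.
have ntc := count_no_trivalent ntT.
rewrite /weave_quiver quiver_op_mk /signed_quiver.
have cnt : size (trivalent_indices (WT ++ WB)) = r.
  by rewrite size_trivalent_indices count_cat ntc (inv_count inv).
have birthE t : (0 < t <= r)%N ->
    nth 0%N (trivalent_indices (WT ++ WB)) t.-1 = (size WT + birth WB t)%N.
  move=> le; rewrite trivalent_indices_prefix // (nth_map 0%N) //.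
  by rewrite size_trivalent_indices (inv_count inv); lia.
have sz : size (D ++ w) = (size D + r)%N by rewrite size_cat sz_w.
have intE p q : (0 < p <= r)%N -> (0 < q <= r)%N ->
    intersection (WT ++ WB) (size (D ++ w)) (nth 0%N (trivalent_indices (WT ++ WB)) p.-1)
      (nth 0%N (trivalent_indices (WT ++ WB)) q.-1) =
    intersection WB (size D + r) (birth WB p) (birth WB q).
  by move=> lep leq; rewrite !birthE // intersection_prefix // sz.
have frozenE p : signed_frozen sw p = (r < nx p)%N.
  by rewrite signed_frozenE size_sw sw_letters.
apply: mk_quiver_eq; first by rewrite cnt.
  rewrite size_sw => p lep; rewrite frozenE // birthE //.
  rewrite -[lusztig_cycle _ _ _ _]/(bottom_cycle _ _ _) bottom_cycle_prefix // sz.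
  rewrite (inv_cycle inv) // -/h -/nx; case: ifP => rn.
    apply/esym/hasP; exists 1%N => //; apply/mapP.
    by exists (simple_root (star w0 (letter h p))); rewrite ?eqxx //; apply: (inv_alive inv).
  by apply/esym/hasP => -[x]; rewrite mem_nseq => /andP[_ /eqP->].
rewrite size_sw => p q lep leq; rewrite !frozenE // negb_and -!leqNgt => nf.
rewrite intE //.
have key j t : (0 < j < t)%N -> (t <= r)%N -> (nx j <= r)%N || (nx t <= r)%N ->
    let I := intersection WB (size D + r) (birth WB j) (birth WB t) in
    signed_arrows C sw t j = Num.max 0 I /\ signed_arrows C sw j t = Num.max 0 (- I).
  move=> jt tr nf'; rewrite /= (inv_intersection inv) // expected_intersection_end; last first.
    by rewrite geq_min.
  have := @signed_arrows_net _ C C_sym C_off sw X; rewrite size_sw sw_letters -/nx.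
  move=> /(_ sw_signs j t jt tr nf')[-> ->].
  have max0 (x : int) : (Num.max 0 x)%:~R = Num.max 0 x%:~R :> rat.
    by rewrite !maxEle ler0z; case: ifP.
  by rewrite !max0 rmorphN.
have [lt|lt|E] := ltngtP p q.
- have [_ ->] := key p q ltac:(lia) ltac:(lia) nf.
  by rewrite -intersection_anti.
- by have [-> _] := key q p ltac:(lia) ltac:(lia) ltac:(lia).
have Iqq : intersection WB (size D + r) (birth WB q) (birth WB q) = 0.
  by have := intersection_anti WB (size D + r) (birth WB q) (birth WB q); lra.
by rewrite E Iqq maxxx signed_arrows_self // size_sw.
Qed.

End SignedWeave.

Lemma ADE_cartan_simply_laced n (C : 'M[int]_n.+1) : ADE_cartan C ->
  [/\ forall i, C i i = 2, forall i j, C i j = C j i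
    & forall i j, i != j -> C i j = 0 \/ C i j = -1].
Proof.
case=> X [p [_ Cp]].
have CE i j : C i j = dynkin_cartan X n (p^-1%g i) (p^-1%g j) by rewrite -Cp !permKV.
split=> [i|i j|i j ij]; rewrite !CE !mxE ?eqxx //.
  by rewrite eq_sym /dynkin_edge orbC.
rewrite (inj_eq perm_inj) (negbTE ij).
by case: ifP => _; [right | left].
Qed.

Lemma braid_eq_word n (C : 'M[int]_n.+1) s t :
  (forall i, C i i = 2) -> (forall i j, C i j = C j i) ->
  braid_eq C s t -> word_mx C s = word_mx C t /\ size s = size t.
Proof.
move=> C_diag C_sym; elim=> //.
- by move=> ? ? _ [-> ->].
- by move=> ? ? ? _ [-> ->] _ [-> ->].
- move=> u v i j _ Cij; rewrite !word_mx_cat !size_cat !word_mx_cons !word_mx0 !mulr1.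
  by rewrite (refl_comm C_sym Cij).
move=> u v i j Cij; rewrite !word_mx_cat !size_cat !word_mx_cons !word_mx0 !mulr1 !mulrA.
by rewrite -!(mulrA (word_mx C u)) (refl_braid C_diag C_sym Cij).
Qed.

Section ChainSignedWord.

Context (n : nat) (C : 'M[int]_n.+1).
Context (C_diag : forall i, C i i = 2).
Context (C_sym : forall i j, C i j = C j i).
Context (C_off : forall i j, i != j -> C i j = 0 \/ C i j = -1).
Context (w : seq 'I_n.+1) (ch : seq (nat * nat)).

Local Notation r := (size w).
Local Notation sw := (chain_signed_word w ch).

Definition sided_letters : seq ('I_n.+1 * side) :=
  [seq (color w ch t, chain_side ch t) | t <- iota 1 r].

Lemma size_chain_signed_word : size sw = r.
Proof. by rewrite size_map size_iota. Qed.

Lemma chain_signed_word_letters : [seq x.2 | x <- sw] = chain_letters w ch.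
Proof. by rewrite -map_comp. Qed.

Lemma sided_letters_letters : [seq x.1 | x <- sided_letters] = chain_letters w ch.
Proof. by rewrite -map_comp. Qed.

Lemma sided_letters_side t : (0 < t <= r)%N ->
  nth Rgt [seq x.2 | x <- sided_letters] t.-1 = chain_side ch t.
Proof.
move=> le; rewrite -map_comp (nth_map 0%N) ?size_iota; last by lia.
by rewrite nth_iota /=; [congr chain_side; lia | lia].
Qed.

Lemma chain_signed_word_sign t : (1 < t <= r)%N ->
  sign_at sw t = if is_right (chain_side ch t) then -1 else 1.
Proof.
move=> le; rewrite /sign_at (nth_map 0%N) ?size_iota; last by lia.
rewrite nth_iota; last by lia.
have -> : (1 + t.-1 = t)%N by lia.
by rewrite /chain_side /= gtn_eqF; [case: LR | lia].
Qed.

Lemma chain_quiver_signed : admissible_chain w ch -> chain_quiver C w ch = signed_quiver C sw.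
Proof.
move=> adm; rewrite /chain_quiver /signed_quiver.
have frE p : signed_frozen sw p = (r < next_pos (chain_letters w ch) p)%N.
  by rewrite signed_frozenE size_chain_signed_word chain_signed_word_letters.
apply: mk_quiver_eq; first by rewrite size_chain_signed_word.
  by move=> p lep; rewrite frE box_frozenE.
have := signed_arrows_net C_sym C_off (sw := sw) (X := chain_side ch).
rewrite size_chain_signed_word chain_signed_word_letters => /(_ chain_signed_word_sign) net.
have max0 p q : (Num.max 0 (- net_arrows C (chain_letters w ch) (chain_side ch) p q) =
     (net_arrows C (chain_letters w ch) (chain_side ch) p q == -1)%:R) *
   (Num.max 0 (net_arrows C (chain_letters w ch) (chain_side ch) p q) =
     (net_arrows C (chain_letters w ch) (chain_side ch) p q == 1)%:R).
  rewrite /net_arrows; case: ifP => _; first by case: ifP => _; [case: is_right|]; split.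
  case: ifP => _; last by split.
  by case: (if _ then _ else _); case: is_right; split.
move=> p q lep leq; rewrite !box_frozenE // negb_and -!leqNgt => nf.
have [lt|lt|<-] := ltngtP p q.
- have [-> _] := net p q ltac:(lia) ltac:(lia) nf.
  have [-> _] := box_arrow_net adm C_diag C_sym (p := p) (q := q) ltac:(lia) ltac:(lia) nf.
  by rewrite max0; case: eqP.
- have [_ ->] := net q p ltac:(lia) ltac:(lia) ltac:(lia).
  have [_ ->] := box_arrow_net adm C_diag C_sym (p := q) (q := p) ltac:(lia) ltac:(lia) ltac:(lia).
  by rewrite max0; case: eqP.
by rewrite box_arrow_self // signed_arrows_self // size_chain_signed_word.
Qed.

End ChainSignedWord.

Theorem corollary8p1 (n : nat) (C : 'M[int]_n.+1) (hC : ADE_cartan C)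
  (w0 : weyl C) (hw0 : longest w0)
  (Delta : seq 'I_n.+1) (hDelta : reduced_word w0 Delta)
  (b : seq 'I_n.+1)
  (D : seq 'I_n.+1) (hD : Seq_of C Delta D)
  (i : seq 'I_n.+1) (hi : Seq_of C b i)
  (ch : seq (nat * nat)) (hch : admissible_chain i ch) :
  chain_quiver C i ch = signed_quiver C (chain_signed_word i ch) /\
  forall W : weave, chain_weave w0 D i ch W ->
    signed_quiver C (chain_signed_word i ch) = quiver_op (weave_quiver (D ++ i) W).
Proof.
have [C_diag C_sym C_off] := ADE_cartan_simply_laced hC.
split; first exact: chain_quiver_signed.
move=> W [WT [WB [s [ntT WTw WBd ->]]]].
have [Dw szD] := braid_eq_word C_diag C_sym hD; have [Delta_w sz_Delta] := hDelta.
have {}Dw : word_mx C D = w0 by rewrite Delta_w Dw.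
have redD : reduced C D.
  by move=> t tD; rewrite -szD sz_Delta; apply: weyl_length_le; rewrite tD.
have sz : size (sided_letters i ch) = size i by rewrite size_map size_iota.
have [fT _] := is_weave_fits ntT WTw.
apply: (signed_quiver_weave C_diag C_sym C_off hw0 redD Dw (hx := sided_letters i ch)) => //.
- by rewrite chain_signed_word_letters sided_letters_letters.
- by move=> t; rewrite sz => le; rewrite chain_signed_word_sign // sided_letters_side //; lia.
by rewrite /lifted_string -map_comp; apply: WBd.
Qed.
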